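(* Assume there exists $q\in\mathbb{N}$, $q\ge2$, such that $h_{\ell+1}\le\frac1q h_\ell$ for all $\ell\in\mathbb{N}_0$. Let $\mathcal{H}$ be a hierarchical basis and let $\mathcal{H}^*$ be a refinement of $\mathcal{H}$. Let $\mathcal{R}:=\mathcal{H}\setminus\mathcal{H}^*$ be the set of refined basis functions. Then $$\mathcal{E}_{\mathcal{H}^*}^2(V,\mathcal{H}^* )\le\mathcal{E}_{\mathcal{H}}^2(V,\mathcal{H})-\lambda\,\mathcal{E}_{\mathcal{H}}^2(V,\mathcal{R}),\qquad\forall\,V\in\operatorname{span}\mathcal{H},$$ where $\lambda:=1-\frac1{q^2}$.
   Context: **Problem data.** $\Omega=[0,1]^d$, $d\ge2$. $\mathcal{A}\in W^{1,\infty}(\Omega;\mathbb{R}^{d\times d})$ is symmetric and there are constants $0<\gamma_1\le\gamma_2$ with $\gamma_1|\xi|^2\le \xi^T\mathcal{A}(x)\xi\le\gamma_2|\xi|^2$ for all $x\in\Omega$, $\xi\in\mathbb{R}^d$; $\bm{b}\in W^{1,\infty}(\Omega;\mathbb{R}^d)$; $c\in L^\infty(\Omega)$; $c-\frac12\operatorname{div}(\bm{b})\ge 0$; $f\in L^2(\Omega)$. **B-splines.** For integers $p\ge1$, $n\ge p+1$, a $p$-open knot vector is a sequence $\Xi=\{\xi_j\}_{j=1}^{n+p+1}$ with $0=\xi_1=\dots=\xi_{p+1}<\xi_{p+2}\le\dots\le\xi_n<\xi_{n+1}=\dots=\xi_{n+p+1}=1$, each internal knot being repeated at most $p+1$ times.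 $\mathcal{B}(\Xi)=\{b_1,\dots,b_n\}$ is the associated (normalized, partition-of-unity) B-spline basis of degree $p$; $b_j$ has local knot vector $\{\xi_j,\dots,\xi_{j+p+1}\}$ and support $[\xi_j,\xi_{j+p+1}]$. The univariate mesh consists of the closed intervals between consecutive distinct knots. Given degrees $\mathbf{p}=(p_1,\dots,p_d)$ and a $p_i$-open knot vector in each direction $i$, the tensor product B-spline basis consists of the functions $\beta(x)=\beta_1(x_1)\cdots\beta_d(x_d)$ with $\beta_i$ in the $i$-th univariate basis; $\omega_\beta:=\operatorname{supp}\beta$ is a closed box. The Cartesian mesh consists of the closed cells $I_1\times\dots\times I_d$ with $I_i$ in the $i$-th univariate mesh. **Levels.** Degrees $\mathbf{p}$ are fixed. For each level $\ell\in\mathbb{N}_0$ there are open knot vectors $\Xi_i^\ell$, $i=1,\dots,d$, such that each knot of $\Xi_i^\ell$ with multiplicity $m$ is a knot of $\Xi_i^{\ell+1}$ with multiplicity at least $m$. $\mathcal{B}_\ell$, $\mathcal{S}_\ell=\operatorname{span}\mathcal{B}_\ell$ and $\mathcal{Q}_\ell$ denote the tensor product B-spline basis, spline space and Cartesian mesh of level $\ell$; thus $\mathcal{S}_0\subset\mathcal{S}_1\subset\cdots$. Each $\beta\in\mathcal{B}_\ell$ is uniquely $\beta=\sum_{\beta'\in\mathcal{B}_{\ell+1}}c_{\beta'}(\beta)\beta'$ with $c_{\beta'}(\beta)\ge0$, and its set of children is $\mathcal{C}(\beta):=\{\beta'\in\mathcal{B}_{\ell+1}: c_{\beta'}(\beta)\ne0\}$.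 Put $h_\ell:=\max_{Q\in\mathcal{Q}_\ell}\operatorname{diam}(Q)$, and for $\beta\in\mathcal{B}_\ell$ put $h_\beta:=h_\ell$. **Hierarchical basis.** A hierarchy of subdomains of depth $n$ is $\mathbf{\Omega}_n=\{\Omega_0,\dots,\Omega_n\}$ with $\Omega=\Omega_0\supset\Omega_1\supset\dots\supset\Omega_{n-1}\supset\Omega_n=\emptyset$, each $\Omega_\ell$ ($1\le\ell\le n-1$) being a union of cells of level $\ell-1$. The associated hierarchical basis is $\mathcal{H}:=\mathcal{H}_{n-1}$, where $\mathcal{H}_0:=\mathcal{B}_0$ and, for $\ell=0,\dots,n-2$, $$\mathcal{H}_{\ell+1}:=\{\beta\in\mathcal{H}_\ell:\operatorname{supp}\beta\not\subset\Omega_{\ell+1}\}\cup\bigcup_{\beta\in\mathcal{H}_\ell,\ \operatorname{supp}\beta\subset\Omega_{\ell+1}}\mathcal{C}(\beta).$$ It is known that there are (unique) coefficients $a_\beta>0$, $\beta\in\mathcal{H}$ (depending on $\mathcal{H}$), with $\sum_{\beta\in\mathcal{H}}a_\beta\beta\equiv1$ on $\Omega$. **Refinement.** A hierarchy $\mathbf{\Omega}^*_{n+1}=\{\Omega_0^*,\dots,\Omega_{n+1}^*\}$ of depth (at most) $n+1$ is an enlargement of $\mathbf{\Omega}_n$ if $\Omega_\ell\subset\Omega_\ell^*$ for $\ell=1,\dots,n$. If $\mathcal{H}$ and $\mathcal{H}^*$ are the hierarchical bases associated with $\mathbf{\Omega}_n$ and with an enlargement $\mathbf{\Omega}_{n+1}^*$,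 then $\mathcal{H}^*$ is called a refinement of $\mathcal{H}$; in this case $\operatorname{span}\mathcal{H}\subset\operatorname{span}\mathcal{H}^*$. **Estimators.** For a hierarchical spline function $V$, $r(V):=f+\operatorname{div}(\mathcal{A}\nabla V)-\bm{b}\cdot\nabla V-cV$ (understood almost everywhere, i.e. in the interior of the mesh cells, on which $V$ is polynomial). For a hierarchical basis $\mathcal{H}$ with coefficients $a_\beta$, $V\in\operatorname{span}\mathcal{H}$, $\beta\in\mathcal{H}$ and $\mathcal{N}\subset\mathcal{H}$, $$\mathcal{E}_{\mathcal{H}}(V,\beta):=\sqrt{a_\beta}\,h_\beta\left(\int_{\omega_\beta}|r(V)|^2\beta\right)^{1/2},\qquad \mathcal{E}_{\mathcal{H}}(V,\mathcal{N}):=\left(\sum_{\beta\in\mathcal{N}}\mathcal{E}_{\mathcal{H}}^2(V,\beta)\right)^{1/2},$$ and analogously for $\mathcal{H}^*$ with its own coefficients. *)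

(* Defs.v *)
From HB Require Import structures.
From mathcomp Require Import all_boot all_order all_algebra.
From mathcomp Require Import all_classical all_reals all_analysis.

Set Implicit Arguments.
Unset Strict Implicit.
Unset Printing Implicit Defensive.
Import Order.TTheory GRing.Theory Num.Theory.
Import numFieldNormedType.Exports.
Local Open Scope classical_set_scope.
Local Open Scope ring_scope.

(* MathComp-Analysis has neither a measurable structure on 'rV[R]_n nor the
   n-dimensional Lebesgue measure; both are built here, with the product
   sigma-algebra (the smallest one making the coordinates Borel measurable). *)
Definition measure_rV_display : measure_display -> measure_display.
Proof. exact. Qed.

Section measurable_rV.
Context (R : realType) (n : nat).

Definition coord_rV (i : 'I_n) (x : 'rV[R]_n) : measurableTypeR R := x 0 i.

Let rV_set0 : g_sigma_preimage coord_rV set0.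
Proof. exact: sigma_algebra0. Qed.

Let rV_setC A : g_sigma_preimage coord_rV A -> g_sigma_preimage coord_rV (~` A).
Proof. exact: sigma_algebraC. Qed.

Let rV_bigcup (F : _^nat) : (forall i, g_sigma_preimage coord_rV (F i)) ->
  g_sigma_preimage coord_rV (\bigcup_i (F i)).
Proof. exact: sigma_algebra_bigcup. Qed.

HB.instance Definition _ := @isMeasurable.Build
  (measure_rV_display default_measure_display) 'rV[R]_n
  (g_sigma_preimage coord_rV) rV_set0 rV_setC rV_bigcup.

Lemma measurable_coord_rV (i : 'I_n) :
  measurable_fun [set: 'rV[R]_n] (coord_rV i).
Proof.
move=> _ Y mY; rewrite setTI; apply: sub_sigma_algebra => /=.
rewrite -bigcup_seq/=; exists i => /=; first by rewrite mem_index_enum.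
by exists Y => //; rewrite setTI.
Qed.

Lemma measurable_fun_rVP d (T : measurableType d) (f : T -> 'rV[R]_n) :
  (forall i, measurable_fun [set: T] (coord_rV i \o f)) ->
  measurable_fun [set: T] f.
Proof.
move=> cf; have : g_sigma_preimage (fun i => coord_rV i \o f) `<=` measurable.
  apply: smallest_sub; first exact: sigma_algebra_measurable.
  elim/big_ind: _ => //; first by move=> A B hA hB C [/hA|/hB].
  by move=> i _ A [B mB <-]; exact: cf.
rewrite g_sigma_preimage_comp => sub _ A mA.
by apply: sub; exists A.
Qed.

End measurable_rV.

Section lebesgue_rV.
Context (R : realType).

Definition cons_rV n (x : measurableTypeR R * 'rV[R]_n) : 'rV[R]_n.+1 :=
  \row_i oapp (x.2 0) x.1 (unlift ord0 i).

Definition uncons_rV n (x : 'rV[R]_n.+1) : measurableTypeR R * 'rV[R]_n :=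
  (x 0 ord0, \row_i x 0 (lift ord0 i)).

Lemma cons_rVK n : cancel (@cons_rV n) (@uncons_rV n).
Proof.
move=> [a x]; rewrite /uncons_rV /cons_rV; congr pair; first by rewrite mxE unlift_none.
by apply/rowP => i; rewrite !mxE liftK.
Qed.

Lemma measurable_cons_rV n : measurable_fun setT (@cons_rV n).
Proof.
apply: measurable_fun_rVP => i; rewrite /comp /coord_rV /cons_rV.
have [j|] := unliftP ord0 i => ->.
  under eq_fun do rewrite mxE liftK /=.
  exact: (measurableT_comp (@measurable_coord_rV R n j) measurable_snd).
under eq_fun do rewrite mxE unlift_none /=.
exact: measurable_fst.
Qed.

Lemma measurable_uncons_rV n : measurable_fun setT (@uncons_rV n).
Proof.
apply/measurable_fun_pairP; split; first exact: (@measurable_coord_rV R n.+1 ord0).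
apply: measurable_fun_rVP => i; rewrite /comp /coord_rV /uncons_rV.
under eq_fun do rewrite mxE /=.
exact: (@measurable_coord_rV R n.+1 (lift ord0 i)).
Qed.

HB.instance Definition _ n := isMeasurableFun.Build _ _ _ _
  (@cons_rV n) (@measurable_cons_rV n).

Section step.
Variables (n : nat) (mu : {sigma_finite_measure set 'rV[R]_n -> \bar R}).

Definition lebesgue_rV_step : set 'rV[R]_n.+1 -> \bar R :=
  pushforward (@lebesgue_measure R \x mu)%E (@cons_rV n).

Let m0 : lebesgue_rV_step set0 = 0%E.
Proof. by rewrite /lebesgue_rV_step /pushforward preimage_set0 measure0. Qed.

Let m_ge0 A : (0 <= lebesgue_rV_step A)%E.
Proof. exact: measure_ge0. Qed.

Let m_sigma_additive : semi_sigma_additive lebesgue_rV_step.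
Proof.
exact: measure_semi_sigma_additive.
Qed.

HB.instance Definition _ := isMeasure.Build _ _ _ lebesgue_rV_step
  m0 m_ge0 m_sigma_additive.

Let m_sigma_finite : sigma_finite setT lebesgue_rV_step.
Proof.
have /sigma_finiteP[F [TF ndF Foo]] := sigma_finiteT (@lebesgue_measure R).
have /sigma_finiteP[G [TG ndG Goo]] := sigma_finiteT mu.
exists (fun k => @uncons_rV n @^-1` (F k `*` G k)).
  apply/esym; rewrite -subTset => x _ /=.
  have [k _ Fk] : (\bigcup_k F k) (x 0 ord0) by rewrite -TF.
  have [l _ Gl] : (\bigcup_k G k) (uncons_rV x).2 by rewrite -TG.
  exists (maxn k l) => //; split => /=.
    by move: Fk; exact/subsetPset/ndF/leq_maxl.
  by move: Gl; exact/subsetPset/ndG/leq_maxr.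
move=> k; have [mF Fk] := Foo k; have [mG Gk] := Goo k; split.
  rewrite -[X in measurable X]setTI.
  by apply: measurable_uncons_rV => //; exact: measurableX.
rewrite /lebesgue_rV_step /pushforward -comp_preimage.
rewrite (_ : _ \o _ = id); last by apply/funext => x /=; rewrite cons_rVK.
by rewrite preimage_id product_measure1E// lte_mul_pinfty// ge0_fin_numE.
Qed.

HB.instance Definition _ := Measure_isSigmaFinite.Build _ _ _ lebesgue_rV_step
  m_sigma_finite.

End step.

Fixpoint lebesgue_rV n : {sigma_finite_measure set 'rV[R]_n -> \bar R} :=
  match n with
  | 0 => [the sigma_finite_measure _ _ of dirac (0 : 'rV[R]_0)]
  | n.+1 => lebesgue_rV_step (lebesgue_rV n)
  end.

End lebesgue_rV.

Section euclidean.
Context (R : realType) (d : nat).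
Implicit Types (u v : 'rV[R]_d) (Q U : set 'rV[R]_d).

Definition dot u v : R := \sum_i u 0 i * v 0 i.

(* The library norm on 'rV[R]_d is the sup norm. *)
Definition enorm u : R := Num.sqrt (dot u u).

Definition diam Q : R := sup [set enorm (z.1 - z.2) | z in Q `*` Q].

Definition cube : set 'rV[R]_d := [set x | forall i, 0 <= x 0 i <= 1].

End euclidean.

Section calculus.
Context (R : realType) (d : nat).
Local Notation leb := (lebesgue_rV R d).
Implicit Types (U : set 'rV[R]_d) (u v w phi V : 'rV[R]_d -> R)
  (F : 'rV[R]_d -> 'rV[R]_d).

Definition unit_vec (i : 'I_d) : 'rV[R]_d := delta_mx 0 i.

Definition grad V (x : 'rV[R]_d) : 'rV[R]_d := \row_i 'D_(unit_vec i) V x.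

(* Measurability is Borel: elements of Lebesgue spaces are given by Borel
   representatives, which always exist. *)
Definition Lp_on U (r : \bar R) u : Prop := u \_ U \in Lfun leb r.

Fixpoint Ck (k : nat) u : Prop :=
  match k with
  | 0 => continuous u
  | k.+1 => continuous u /\ forall i, (forall x, derivable u x (unit_vec i)) /\
              Ck k (fun x => 'D_(unit_vec i) u x)
  end.

Definition test_function U phi : Prop :=
  [/\ forall k, Ck k phi, compact (closure [set x | phi x != 0]) &
      closure [set x | phi x != 0] `<=` U].

Definition weak_partial U (i : 'I_d) u v : Prop :=
  forall phi, test_function U phi ->
    \int[leb]_(x in U) (u x * 'D_(unit_vec i) phi x) =
    - \int[leb]_(x in U) (v x * phi x).

Definition W1inf U u : Prop :=
  Lp_on U +oo%E u /\
  forall i, exists2 v, Lp_on U +oo%E v & weak_partial U i u v.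

Definition is_weak_div U F w : Prop :=
  forall phi, test_function U phi ->
    \int[leb]_(x in U) dot (F x) (grad phi x) =
    - \int[leb]_(x in U) (w x * phi x).

(* The divergence of a field which has a divergence in L^oo(U): it is then
   unique almost everywhere on U, and one representative is chosen. *)
Definition wdiv U F : 'rV[R]_d -> R :=
  xget (fun=> 0) [set w | Lp_on U +oo%E w /\ is_weak_div U F w].

Definition polynomial_fun (P : 'rV[R]_d -> R) : Prop :=
  exists s : seq (R * {ffun 'I_d -> nat}),
    forall x, P x = \sum_(m <- s) m.1 * \prod_i x 0 i ^+ m.2 i.

(* The open subset of ]0, 1[^d of the points near which V is polynomial. For a
   spline V it contains the interiors of the cells of any mesh on which V is
   piecewise polynomial, hence almost all of the cube. *)
Definition regular_set V : set 'rV[R]_d :=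
  (@cube R d)° `&`
  [set x | exists2 P, polynomial_fun P & \forall y \near x, V y = P y].

Variables (A : 'rV[R]_d -> 'M[R]_d) (b : 'rV[R]_d -> 'rV[R]_d)
  (c f : 'rV[R]_d -> R).

(* r(V), set to 0 on the null set of the points of the cube where V is not
   locally polynomial; div is taken inside the cells only, so the jumps of V
   and of its gradient across cell interfaces do not contribute. *)
Definition residual V : 'rV[R]_d -> R :=
  (fun x => f x
     + wdiv (regular_set V) (fun y => grad V y *m (A y)^T) x
     - dot (b x) (grad V x) - c x * V x) \_ (regular_set V).

End calculus.

Section splines.
Context (R : realType).
Implicit Types (p k j : nat) (Xi : seq R) (x : R).

Definition open_knot_vector p Xi : Prop :=
  exists s : seq R,
    [/\ Xi = nseq p.+1 0 ++ s ++ nseq p.+1 1, sorted <=%R s,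
        all (fun t => 0 < t < 1) s &
        forall t, (count_mem t s <= p.+1)%N].

(* Cox-de Boor recursion, with 0-based indices. The convention 0 / 0 = 0 is
   that of x / 0 = 0 in MathComp. Splines are right-continuous on [0, 1[ and
   left-continuous at 1, and vanish outside [0, 1]. *)
Fixpoint bspline Xi k j x : R :=
  match k with
  | 0 => ((Xi`_j <= x < Xi`_j.+1) ||
          [&& x == 1, Xi`_j < 1 & Xi`_j.+1 == 1])%:R
  | k'.+1 =>
      (x - Xi`_j) / (Xi`_(j + k) - Xi`_j) * bspline Xi k' j x +
      (Xi`_(j + k).+1 - x) / (Xi`_(j + k).+1 - Xi`_j.+1) * bspline Xi k' j.+1 x
  end.

Definition mesh1 Xi : set (set R) :=
  [set I | exists j, [/\ (j.+1 < size Xi)%N, Xi`_j < Xi`_j.+1 &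
                         I = [set x | Xi`_j <= x <= Xi`_j.+1]]].

End splines.

(* A basis function of level l is designated by l and by its multi-index. The
   same function may belong to the bases of two levels; since h_beta and the
   children of beta depend on the level, the two are kept distinct. *)
Definition label (d : nat) : Type := (nat * {ffun 'I_d -> nat})%type.

Section hierarchical.
Context (R : realType) (d : nat).
Variables (p : 'I_d -> nat) (Xi : nat -> 'I_d -> seq R).
Implicit Types (l n : nat) (be : label d) (x : 'rV[R]_d).
Local Notation leb := (lebesgue_rV R d).

Definition nested_knots : Prop :=
  forall l i t, (count_mem t (Xi l i) <= count_mem t (Xi l.+1 i))%N.

Definition tbasis l : set (label d) :=
  [set be : label d | be.1 = l /\ forall i, (be.2 i < size (Xi l i) - (p i).+1)%N].

Definition tbspline be x : R :=
  \prod_i bspline (Xi be.1 i) (p i) (be.2 i) (x 0 i).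

Definition supp be : set 'rV[R]_d := closure [set x | tbspline be x != 0].

Definition mesh l : set (set 'rV[R]_d) :=
  [set Q | exists2 I : 'I_d -> set R, forall i, mesh1 (Xi l i) (I i) &
           Q = [set x : 'rV[R]_d | forall i, I i (x 0 i)]].

Definition meshsize l : R := sup [set diam Q | Q in mesh l].

(* The (unique) coefficients of the two-scale relation. *)
Definition two_scale (cf : label d -> label d -> R) : Prop :=
  forall l be, tbasis l be ->
    (forall be', tbasis l.+1 be' -> 0 <= cf be be') /\
    forall x, cube x ->
      tbspline be x = \sum_(be' \in tbasis l.+1) cf be be' * tbspline be' x.

Definition children (cf : label d -> label d -> R) be : set (label d) :=
  [set be' : label d | tbasis be.1.+1 be' /\ cf be be' != 0].

Definition hierarchy n (Om : nat -> set 'rV[R]_d) : Prop :=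
  [/\ Om 0%N = @cube R d, Om n = set0,
      forall l, (l < n)%N -> Om l.+1 `<=` Om l &
      forall l, (1 <= l <= n.-1)%N ->
        exists2 C, C `<=` mesh l.-1 & Om l = \bigcup_(Q in C) Q].

Definition enlargement n (Om Oms : nat -> set 'rV[R]_d) : Prop :=
  hierarchy n.+1 Oms /\ forall l, (1 <= l <= n)%N -> Om l `<=` Oms l.

Fixpoint hbasis_rec cf (Om : nat -> set 'rV[R]_d) l : set (label d) :=
  match l with
  | 0 => tbasis 0
  | l'.+1 =>
      [set be | hbasis_rec cf Om l' be /\ ~ (supp be `<=` Om l)] `|`
      \bigcup_(be in [set be | hbasis_rec cf Om l' be /\ supp be `<=` Om l])
        children cf be
  end.

Definition hbasis cf n Om := hbasis_rec cf Om n.-1.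

Definition partition_coefs (H : set (label d)) (a : label d -> R) : Prop :=
  (forall be, H be -> 0 < a be) /\
  forall x, cube x -> \sum_(be \in H) a be * tbspline be x = 1.

Definition hspan (H : set (label d)) : set ('rV[R]_d -> R) :=
  [set V | exists cV : label d -> R,
             V = fun x => \sum_(be \in H) cV be * tbspline be x].

(* r stands for the residual of V. *)
Definition local_estimator (a : label d -> R) (r : 'rV[R]_d -> R) be : R :=
  Num.sqrt (a be) * meshsize be.1 *
  Num.sqrt (\int[leb]_(x in supp be) (`|r x| ^+ 2 * tbspline be x)).

Definition estimator a r (N : set (label d)) : R :=
  Num.sqrt (\sum_(be \in N) local_estimator a r be ^+ 2).

End hierarchical.

(* Main.v *)
Require Import Defs.
From HB Require Import structures.
From mathcomp Require Import all_boot all_order all_algebra.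
From mathcomp Require Import all_classical all_reals all_analysis.
From mathcomp Require Import finmap measurable_realfun ess_sup_inf ring lra zify.
Import Order.TTheory GRing.Theory Num.Theory.
Import numFieldNormedType.Exports.
Local Open Scope classical_set_scope.
Local Open Scope ring_scope.
Set Implicit Arguments.
Unset Strict Implicit.
Unset Printing Implicit Defensive.

(* Two-scale relations write every [be] in H as a combination of H* with
   nonnegative coefficients, in which only functions of levels at least that of
   [be] occur, and of strictly larger levels if [be] is not in H*. Substituting
   these in the partition of unity of H gives a partition of unity over H*; as
   H* is linearly independent, its coefficients are the [as_]. Hence both
   estimators are sums of the integrals of [r^2 be*], be* in H*, and the
   inequality holds term by term because the mesh size drops by a factor [q]
   between levels.

   Independence of H*: B-splines of one level are locally linearly independent
   (Marsden's identity and a Vandermonde matrix), a function of level l in H*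
   does not vanish identically outside Omega*_(l+1), and all functions of larger
   levels vanish there.

   The integrals are additive because [r^2] is integrable: [r] is the sum of [f]
   and of an essentially bounded function, the gradient of a spline being bounded
   where it exists. *)

(** * Univariate B-splines *)

Section bspline_theory.
Context (R : realType).
Implicit Types (p k j m : nat) (Xi : seq R) (x y : R).

(** The condition under which the degree-0 B-spline [m] equals 1: spans are half-open, except that a
    span ending at 1 also contains 1. *)
Definition in_span Xi m x : bool :=
  (Xi`_m <= x < Xi`_m.+1) || [&& x == 1, Xi`_m < 1 & Xi`_m.+1 == 1].

(** Local support in terms of span indices, which is insensitive to repeated knots: a recursion step
    uses only the indices [j] and [j.+1], so degree [k] reaches at most the span [j + k]. *)
Lemma bspline_neq0 Xi k j x : bspline Xi k j x != 0 ->
  exists2 m, (j <= m <= j + k)%N & in_span Xi m x.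
Proof.
elim: k j => [|k IH] j /=.
  rewrite -/(in_span Xi j x); case E: in_span; last by rewrite eqxx.
  by move=> _; exists j => //; rewrite addn0 leqnn.
have [->|/IH[m jm sm] _] := eqVneq (bspline Xi k j x) 0; last first.
  by exists m => //; lia.
have [->|/IH[m jm sm] _] := eqVneq (bspline Xi k j.+1 x) 0; last first.
  by exists m => //; lia.
by rewrite !mulr0 addr0 eqxx.
Qed.

Definition knots Xi : Prop :=
  sorted <=%R Xi /\ all (fun t => 0 <= t <= 1) Xi.

Lemma knots_le Xi i j : knots Xi -> (i <= j)%N -> (j < size Xi)%N ->
  Xi`_i <= Xi`_j.
Proof.
move=> [s _] ij jn; apply: (sorted_leq_nth le_trans le_refl) => //.
by rewrite inE (leq_ltn_trans ij).
Qed.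

(** Past the end, [nth] returns the default 0, which also lies in [0, 1]. *)
Lemma knots_01 Xi i : knots Xi -> 0 <= Xi`_i <= 1.
Proof.
move=> [_ /allP h]; have [ilt|ige] := ltnP i (size Xi); first exact/h/mem_nth.
by rewrite nth_default// lexx ler01.
Qed.

Lemma in_span_lt Xi m x : knots Xi -> in_span Xi m x ->
  (m.+1 < size Xi)%N /\ Xi`_m < Xi`_m.+1.
Proof.
move=> kXi h; split.
  (* An out-of-range right knot would read as the default 0, which leaves no room for a span. *)
  rewrite ltnNge; apply/negP => mge; move: h; rewrite /in_span (nth_default _ mge).
  have /andP[m0 _] := knots_01 m kXi.
  by move=> /orP[/andP[? ?]|/and3P[_ _]]; [lra|]; rewrite eq_sym oner_eq0.
by case/orP: h => [/andP[xl xr]|/and3P[_ ? /eqP ->]] //; exact: le_lt_trans xl xr.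
Qed.

Lemma in_span_itv Xi m x : in_span Xi m x -> Xi`_m <= x <= Xi`_m.+1.
Proof. by rewrite /in_span => /orP[/andP[? ?]|/and3P[/eqP-> ? /eqP->]]; lra. Qed.

Lemma in_span_inj Xi i j x : knots Xi -> in_span Xi i x -> in_span Xi j x -> i = j.
Proof.
move=> kXi; wlog ij : i j / (i <= j)%N.
  by move=> W hi hj; have [ij|/ltnW ij] := leqP i j; [|apply/esym]; exact: W.
move=> hi hj; apply/eqP; rewrite eqn_leq ij /= leqNgt; apply/negP => ltij.
have [js jlt] := in_span_lt kXi hj.
have le1 : Xi`_i.+1 <= Xi`_j by apply: knots_le => //; lia.
have /andP[_ jle] := knots_01 j.+1 kXi.
have /andP[jx _] := in_span_itv hj.
case/orP: hi => [/andP[_ ?]|/and3P[/eqP x1 _ /eqP i1]]; first by lra.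
by move: jlt; rewrite i1 in le1; lra.
Qed.

(** A Cox-de Boor weight may be negative outside the support of the B-spline it multiplies, so its
    sign is examined only where that factor is nonzero. *)
Lemma bspline_ge0 Xi k j x : knots Xi -> (j + k.+1 < size Xi)%N ->
  0 <= bspline Xi k j x.
Proof.
move=> kXi; elim: k j => [|k IH] j js /=; first by case: (_ || _).
apply: addr_ge0.
- have [->|n0] := eqVneq (bspline Xi k j x) 0; first by rewrite mulr0.
  have [m /andP[jm mk] /in_span_itv/andP[x1 _]] := bspline_neq0 n0.
  rewrite mulr_ge0 ?IH//; last by lia.
  have ? : Xi`_j <= Xi`_m by apply: knots_le => //; lia.
  have ? : Xi`_j <= Xi`_(j + k.+1) by apply: knots_le => //; lia.
  by rewrite divr_ge0 ?subr_ge0//; lra.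
- have [->|n0] := eqVneq (bspline Xi k j.+1 x) 0; first by rewrite mulr0.
  have [m /andP[jm mk] /in_span_itv/andP[_ x1]] := bspline_neq0 n0.
  rewrite mulr_ge0 ?IH//; last by lia.
  have ? : Xi`_m.+1 <= Xi`_(j + k.+1).+1 by apply: knots_le => //; lia.
  have ? : Xi`_j.+1 <= Xi`_(j + k.+1).+1 by apply: knots_le => //; lia.
  by rewrite divr_ge0 ?subr_ge0//; lra.
Qed.

Lemma bspline_out Xi k j x : knots Xi -> bspline Xi k j x != 0 -> 0 <= x <= 1.
Proof.
move=> kXi /bspline_neq0[m _ /in_span_itv/andP[? ?]].
by have := knots_01 m kXi; have := knots_01 m.+1 kXi; lra.
Qed.

(* Marsden's identity, in the homogeneous form whose dual polynomials
   are polynomials in [z] with constant term 1. *)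
Lemma marsden Xi k m N x z : knots Xi -> in_span Xi m x ->
  (k <= m)%N -> (m + k < size Xi)%N -> (m < N)%N ->
  \sum_(j < N) (\prod_(i < k) (1 - z * Xi`_(j + i.+1))) * bspline Xi k j x
    = (1 - z * x) ^+ k.
Proof.
move=> kXi sm; elim: k => [|k IH] km mk mN.
  rewrite expr0 (bigD1 (Ordinal mN))//= big_ord0 mul1r -/(in_span _ _ _) sm big1 ?addr0//.
  move=> j /eqP jm; rewrite big_ord0 mul1r -/(in_span _ _ _).
  case: (boolP (in_span _ _ _)) => // sj; case: jm.
  by apply/val_inj; exact: in_span_inj sj sm.
have B0 j : ~~ (j <= m <= j + k)%N -> bspline Xi k j x = 0.
  move=> h; apply: contraNeq h => /bspline_neq0[m' jm' sm'].
  by rewrite (in_span_inj kXi sm sm').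
pose psi k j := \prod_(i < k) (1 - z * Xi`_(j + i.+1)).
(* The B-spline [j] of degree [k.+1] is [T j + U j.+1]. Shifting the [U] terms by one index collects
   the multiples of the B-spline [j] of degree [k]; the two weights interpolate the affine function
   1 - z t at two knots, which yields the factor [1 - z * x]. *)
pose T j := (x - Xi`_j) / (Xi`_(j + k.+1) - Xi`_j) * bspline Xi k j x.
pose U j := (Xi`_(j + k.+1) - x) / (Xi`_(j + k.+1) - Xi`_j) * bspline Xi k j x.
have UN : U N = 0 by rewrite /U B0 ?mulr0//; lia.
have U0 : U 0%N = 0 by rewrite /U B0 ?mulr0//; lia.
(* The truncated predecessor at [j = 0] is harmless because [U 0] vanishes. *)
pose s j := psi k.+1 j.-1 * U j.
transitivity (\sum_(j < N) (psi k.+1 j * T j + s j.+1)).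
  by apply: eq_bigr => j _ /=; rewrite /s /psi /T /U mulrDr.
rewrite big_split/=.
have -> : \sum_(j < N) s j.+1 = \sum_(j < N) s j.
  have : \sum_(j < N.+1) s j = \sum_(j < N) s j by rewrite big_ord_recr/= /s UN mulr0 addr0.
  by rewrite big_ord_recl/= {1}/s U0 mulr0 add0r.
rewrite -big_split/= exprS -IH; [|lia|lia|lia].
rewrite mulr_sumr; apply: eq_bigr => j _; rewrite -/(psi k j).
have [jm|/B0 B00] := boolP (j <= m <= j + k)%N; last first.
  by rewrite /s /T /U B00 !mulr0 addr0.
have den : Xi`_(j + k.+1) - Xi`_j != 0.
  have [_ sl] := in_span_lt kXi sm; rewrite subr_eq0 gt_eqF//.
  have ? : Xi`_m.+1 <= Xi`_(j + k.+1) by apply: knots_le => //; lia.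
  have ? : Xi`_j <= Xi`_m by apply: knots_le => //; lia.
  lra.
have p1 : psi k.+1 j = psi k j * (1 - z * Xi`_(j + k.+1)).
  by rewrite /psi big_ord_recr.
have p2 : U j = 0 \/ psi k.+1 j.-1 = (1 - z * Xi`_j) * psi k j.
  case E : (nat_of_ord j) => [|j']; [by left|right].
  rewrite /psi big_ord_recl/= addn1; congr (_ * _); apply: eq_bigr => i _.
  by rewrite /bump/= -addSnnS.
rewrite /s p1; case: p2 => [U00|->]; rewrite /T /U.
  have j0 : Xi`_(j + k.+1) - x = 0 \/ bspline Xi k j x = 0.
    move: U00; rewrite /U => /eqP; rewrite !mulf_eq0 invr_eq0 (negPf den) orbF.
    by move=> /orP[]/eqP; [left|right].
  case: j0 => j0; last by rewrite j0 !mulr0 addr0.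
  rewrite -/(U j) U00 mulr0 addr0.
  have -> : Xi`_(j + k.+1) = x by apply/eqP; rewrite -subr_eq0 j0.
  have xj : x - Xi`_j != 0.
    by rewrite -[x](subrK (Xi`_(j + k.+1))) -[x - _]opprB j0 oppr0 add0r.
  by rewrite divff// mul1r; ring.
by field.
Qed.

(** The B-splines [m - p + a] are those active on the span [m]. By Marsden's identity with
    [z = y c], the dual polynomials [Psi] turn their collocation matrix [B] into the matrix of
    entries (1 - y_c y_b)^p. The binomial theorem factors the latter as V^T D V, with V a
    Vandermonde matrix and D diagonal with signed binomial coefficients. Both have nonzero
    determinant, hence so does [B], and [W] is its inverse. *)
Lemma bspline_unisolvent Xi p m (y : 'I_p.+1 -> R) : knots Xi -> injective y ->
  (forall b, in_span Xi m (y b)) -> (p <= m)%N -> (m + p < size Xi)%N ->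
  exists W : 'M[R]_p.+1, forall a a' : 'I_p.+1,
    \sum_b bspline Xi p (m - p + a) (y b) * W b a' = (a == a')%:R.
Proof.
move=> kXi yinj ym pm ms.
pose B := \matrix_(a < p.+1, b < p.+1) bspline Xi p (m - p + a) (y b).
suff uB : B \in unitmx.
  exists (invmx B) => a a'; have := mulmxV uB; move=> /matrixP/(_ a a').
  by rewrite !mxE => <-; apply: eq_bigr => b _; rewrite !mxE.
pose Psi := \matrix_(c < p.+1, a < p.+1)
  \prod_(i < p) (1 - y c * Xi`_(m - p + a + i.+1)).
pose yr := \row_i y i.
pose D := diag_mx (\row_(i < p.+1) ((-1) ^+ i * 'C(p, i)%:R : R)).
have E : Psi *m B = (Vandermonde p.+1 yr)^T *m (D *m Vandermonde p.+1 yr).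
  apply/matrixP => c b; rewrite !mxE.
  transitivity ((1 - y c * y b) ^+ p).
    rewrite -(@marsden Xi p m m.+1) //.
    rewrite [RHS](bigID (fun j : 'I_m.+1 => (m - p <= j)%N))/=.
    rewrite [X in _ + X]big1 ?addr0; last first.
      move=> j mpj; have [->|/bspline_neq0[m' jm' sm']] := eqVneq (bspline Xi p j (y b)) 0.
        by rewrite mulr0.
      by have := in_span_inj kXi (ym b) sm'; lia.
    under eq_bigr do rewrite !mxE.
    rewrite (reindex_onto (fun a : 'I_p.+1 => inord (m - p + a) : 'I_m.+1)
       (fun j : 'I_m.+1 => inord (j - (m - p)))) /=; last first.
      by move=> j mpj; apply/val_inj; rewrite /= !inordK ?subnKC//; have := ltn_ord j; lia.
    apply: eq_big => a.
      rewrite !inordK; [|by have := ltn_ord a; lia].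
      rewrite leq_addr/=; apply/esym/eqP/val_inj; rewrite /= inordK; have := ltn_ord a; lia.
    by move=> _; rewrite inordK//; have := ltn_ord a; lia.
  rewrite exprBn; apply: eq_bigr => i _; rewrite expr1n mulr1 mul_diag_mx !mxE.
  by rewrite exprMn -[in RHS]mulrA -mulr_natr; ring.
have dV : \det (Vandermonde p.+1 yr) != 0.
  rewrite det_Vandermonde; apply/prodf_neq0 => i _; apply/prodf_neq0 => j ij.
  rewrite !mxE subr_eq0; apply: contraTneq ij => /yinj ->; by rewrite ltnn.
have dD : \det D != 0.
  rewrite det_diag; apply/prodf_neq0 => i _; rewrite !mxE mulf_neq0 ?expf_neq0 ?oppr_eq0 ?oner_eq0//.
  by rewrite pnatr_eq0 -lt0n bin_gt0 -ltnS.
have := congr1 determinant E; rewrite !det_mulmx det_tr => dE.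
rewrite unitmxE unitfE; apply/negP => /eqP B0; move/eqP: dE.
by rewrite B0 mulr0 eq_sym !mulf_eq0 (negPf dV) (negPf dD).
Qed.

Lemma open_knots p Xi : open_knot_vector p Xi -> knots Xi.
Proof.
move=> [s [-> ss sa _]]; split; last first.
  rewrite !all_cat !all_nseq !lexx ler01 !orbT/= andbT.
  by apply: sub_all sa => t; lra.
have T : transitive (<=%R : rel R) by exact: le_trans.
rewrite !sorted_pairwise// !pairwise_cat allrel_catr.
have sn k (t : R) : pairwise <=%R (nseq k t).
  by rewrite -sorted_pairwise//; case: k => // k; elim: k => //= k ->; rewrite lexx.
have ar (s1 s2 : seq R) : (forall u v, u \in s1 -> v \in s2 -> u <= v) -> allrel <=%R s1 s2.
  by move=> h; apply/allrelP => u v; exact: h.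
rewrite !sn -sorted_pairwise// ss !andbT/=.
move/allP in sa; rewrite -![_ :: nseq p _]/(nseq p.+1 _).
apply/andP; split; last first.
  by apply: ar => u v /sa/andP[? ?] /[!mem_nseq]/andP[_ /eqP->]; lra.
apply/andP; split; apply: ar => u v /[!mem_nseq]/andP[_ /eqP->].
  by move=> /sa/andP[? ?]; lra.
by move=> /andP[_ /eqP->].
Qed.

(** The p+1 coincident knots at either end bound no nonempty span. Hence a full set of p+1 B-splines
    is active on every span. *)
Lemma open_in_span p Xi m x : open_knot_vector p Xi -> in_span Xi m x ->
  (p <= m)%N /\ (m + p.+1 < size Xi)%N.
Proof.
move=> oXi sm; have kXi := open_knots oXi.
have [m1 mlt] := in_span_lt kXi sm.
case: oXi => s [E _ _ _].
have lo i : (i <= p)%N -> Xi`_i = 0.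
  by move=> ip; rewrite E nth_cat size_nseq ltnS ip nth_nseq ltnS ip.
have hi i : (i < size Xi)%N -> (size Xi <= i + p.+1)%N -> Xi`_i = 1.
  move=> iS Si; rewrite E catA nth_cat.
  have -> : (i < size (nseq p.+1 0%R ++ s))%N = false.
    by apply/negbTE; move: Si; rewrite E !size_cat !size_nseq -leqNgt addnA leq_add2r.
  rewrite nth_nseq; case: ifP => // /negP[]; move: iS Si; rewrite E !size_cat !size_nseq.
  by move: (size s) => k; clear; lia.
split.
  rewrite leqNgt; apply/negP => mp; move: mlt; rewrite !lo//; [lra|lia].
rewrite ltnNge; apply/negP => mp; move: mlt.
by rewrite (hi m.+1)// ?hi//; [lra|lia|lia].
Qed.

(* A local dual functional of [b_j]; unlike linear independence itself, this
   form passes directly to tensor products. *)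
Lemma bspline_dual Xi p j N x (e : R) : open_knot_vector p Xi -> 0 < e ->
  bspline Xi p j x != 0 -> (p < N)%N ->
  exists w y : 'I_N -> R, [/\ forall b, `|y b - x| < e, forall b, 0 <= y b <= 1 &
    forall k, \sum_b w b * bspline Xi p k (y b) = (k == j)%:R].
Proof.
move=> oXi e0 /[dup] Bj /bspline_neq0[m jm sm] pN.
have kXi := open_knots oXi.
have [pm ms] := open_in_span oXi sm.
have [_ mlt] := in_span_lt kXi sm.
(* The nodes [x + b * h] must stay in the half-open span: they go to the right of [x], but to the
   left when [x = 1]. Dividing the available gap by p+2 keeps p+1 steps strictly inside it. *)
have [h [h0 hs hb]] : exists h : R, [/\ h != 0,
    forall t, 0 <= t <= p.+1%:R -> in_span Xi m (x + t * h) &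
    forall t, 0 <= t <= p.+1%:R -> `|t * h| < e].
  have P0 : 0 < p.+2%:R :> R by rewrite ltr0n.
  have key g : 0 < g -> exists2 h : R, 0 < h & forall t, 0 <= t <= p.+1%:R -> 0 <= t * h < g.
    move=> g0; exists (g / p.+2%:R); first by rewrite divr_gt0.
    move=> t /andP[t0 tp]; rewrite mulr_ge0//= ?divr_ge0 ?ltW//=.
    rewrite mulrA ltr_pdivrMr// mulrC ltr_pM2l//.
    by rewrite (le_lt_trans tp)// ltr_nat.
  case/orP: (sm) => [/andP[x1 x2]|/and3P[/eqP x1 l1 /eqP l2]].
  - have g0 : 0 < Num.min e (Xi`_m.+1 - x) by rewrite lt_min e0 subr_gt0.
    have [h h0 hh] := key _ g0; exists h; split; first by rewrite gt_eqF.
      move=> t /hh/andP[th]; rewrite lt_min => /andP[_ ?].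
      by apply/orP; left; apply/andP; split; lra.
    by move=> t /hh/andP[th]; rewrite lt_min ger0_norm// => /andP[].
  - have g0 : 0 < Num.min e (1 - Xi`_m) by rewrite lt_min e0 subr_gt0.
    have [h h0 hh] := key _ g0; exists (- h); split.
      + by rewrite oppr_eq0 gt_eqF.
      + move=> t /hh/andP[th]; rewrite lt_min => /andP[_ ?].
        have [t0|t0] := eqVneq (t * h) 0; first by rewrite mulrN t0 oppr0 addr0.
        apply/orP; left; apply/andP; split; first by lra.
        by rewrite l2 x1; move: t0; rewrite neq_lt => /orP[]; lra.
      + by move=> t /hh/andP[th]; rewrite lt_min mulrN normrN ger0_norm// => /andP[].
pose y0 (b : 'I_p.+1) := x + b%:R * h.
have bb (b : 'I_p.+1) : 0 <= (b%:R : R) <= p.+1%:R by rewrite ler0n ler_nat ltnW.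
have yinj : injective y0.
  by move=> b b' /addrI/(mulIf h0)/eqP; rewrite eqr_nat => /eqP/val_inj.
have mps : (m + p < size Xi)%N by lia.
have [W HW] := bspline_unisolvent kXi yinj (fun b => hs _ (bb b)) pm mps.
have jlt : (j - (m - p) < p.+1)%N by lia.
pose j0 := Ordinal jlt.
(* Nodes beyond the first p+1 are placed at [x] with weight 0, so that a single [N] can serve
   directions of different degrees. *)
exists (fun b => if (b < p.+1)%N then W (inord b) j0 else 0).
exists (fun b => if (b < p.+1)%N then y0 (inord b) else x).
split.
- move=> b; case: ifP => _; last by rewrite subrr normr0.
  by rewrite /y0 addrC addKr; exact/hb/bb.
- move=> b; suff /in_span_itv : in_span Xi m (if (b < p.+1)%N then y0 (inord b) else x).
    by have := knots_01 m kXi; have := knots_01 m.+1 kXi; lra.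
  by case: ifP => // _; exact/hs/bb.
move=> k.
have pN1 : (p.+1 <= N)%N by [].
rewrite (bigID (fun b : 'I_N => (b < p.+1)%N))/= [X in _ + X]big1 ?addr0; last first.
  by move=> b /negbTE ->; rewrite mul0r.
rewrite -(big_ord_widen N (fun b => (if (b < p.+1)%N then W (inord b) j0 else 0) * bspline Xi p k (if (b < p.+1)%N then y0 (inord b) else x)) pN1).
under eq_bigr => b _ do rewrite ltn_ord !inord_val mulrC.
have [km|km] := boolP ((m - p <= k) && (k <= m))%N.
  have klt : (k - (m - p) < p.+1)%N by lia.
  have := HW (Ordinal klt) j0; rewrite /= subnKC; last by lia.
  by move=> ->; congr (nat_of_bool _)%:R; rewrite -val_eqE /=; lia.
rewrite big1; last first.
  move=> b _; have [->|] := eqVneq (bspline Xi p k (y0 b)) 0; first by rewrite mul0r.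
  move=> /bspline_neq0[m' km' sm']; have := in_span_inj kXi sm' (hs _ (bb b)).
  lia.
by case: eqP => // kj; move: km; rewrite kj; lia.
Qed.

End bspline_theory.

(** * Tensor products *)

Section tensor_product.
Context (R : realType) (d : nat).
Variables (p : 'I_d -> nat) (Xi : nat -> 'I_d -> seq R).
Hypothesis Xi_open : forall l i, open_knot_vector (p i) (Xi l i).
Implicit Types (be : label d) (x : 'rV[R]_d).
Local Notation tb := (tbspline p Xi).

Lemma tbspline_ge0 l be x : tbasis p Xi l be -> 0 <= tb be x.
Proof.
move=> [<- h]; apply: prodr_ge0 => i _; apply: bspline_ge0; first exact: open_knots.
by have := h i; lia.
Qed.

Lemma tbspline_cube be x : tb be x != 0 -> cube x.
Proof.
by move=> /prodf_neq0 h i; apply: bspline_out (h i isT); exact: open_knots.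
Qed.

Lemma tbspline_supp be x : tb be x != 0 -> supp p Xi be x.
Proof. by move=> h; apply: subset_closure. Qed.

Lemma finite_tbasis l : finite_set (tbasis p Xi l).
Proof.
pose N := (\max_i size (Xi l i)).+1.
pose g (u : {ffun 'I_d -> 'I_N}) : label d := (l, [ffun i => val (u i)]).
apply: (@sub_finite_set _ _ (range g)); last exact/finite_image/finite_finset.
move=> [l' u] [/= -> h]; exists [ffun i => inord (u i)] => //; rewrite /g; congr pair.
apply/ffunP => i; rewrite !ffunE /= inordK // ltnS.
by apply: (leq_trans _ (leq_bigmax i)); have /= := h i; lia.
Qed.

Lemma closed_mesh l (Q : set 'rV[R]_d) : mesh Xi l Q -> closed Q.
Proof.
move=> [I hI ->]; rewrite (_ : mkset _ =
    \bigcap_(i in [set: 'I_d]) ((fun x : 'rV[R]_d => x 0 i) @^-1` I i)); last first.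
  by apply/seteqP; split=> x /= h i; [move=> _; exact: h|exact: (h i Logic.I)].
apply: closed_bigI => i _; have [j [_ _ ->]] := hI i.
apply: closed_comp; first by move=> x _; exact: coord_continuous.
by rewrite -set_itvcc; exact: itv_closed.
Qed.

Lemma finite_mesh l : finite_set (mesh Xi l).
Proof.
pose N := (\max_i size (Xi l i)).+1.
pose g (u : {ffun 'I_d -> 'I_N}) : set 'rV[R]_d :=
  [set x | forall i, (Xi l i)`_(u i) <= x 0 i <= (Xi l i)`_(u i).+1].
apply: (@sub_finite_set _ _ (range g)); last exact/finite_image/finite_finset.
move=> Q [I hI ->].
have /choice[u hu] i : exists j : 'I_N,
    I i = [set t | (Xi l i)`_j <= t <= (Xi l i)`_j.+1].
  have [j [js _ ->]] := hI i.
  have jN : (j < N)%N by rewrite ltnS (leq_trans _ (leq_bigmax i))//; lia.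
  by exists (Ordinal jN).
exists (finfun u) => //; apply/seteqP; split=> x /= h i; have := h i; by rewrite ffunE hu.
Qed.

(** The tensor product of the dual functionals of the univariate factors of [be] samples only points
    of the cube within [e] of [x]. Distributing the product over the sum shows that it maps [be] to
    1 and every other B-spline of level [l] to 0. *)
Lemma tbspline_local_independence l (D : label d -> R) x (e : R) be : 0 < e ->
  tbasis p Xi l be -> tb be x != 0 ->
  (forall y, cube y -> (forall i, `|y 0 i - x 0 i| < e) ->
     \sum_(be' \in tbasis p Xi l) D be' * tb be' y = 0) ->
  D be = 0.
Proof.
move=> e0 bl /prodf_neq0 bx D0; have [b1 _] := bl.
pose N := (\max_i p i).+1.
have /choice[w /choice[y wyP]] i : exists w y : 'I_N -> R,
   [/\ forall b, `|y b - x 0 i| < e, forall b, 0 <= y b <= 1 &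
    forall k, \sum_b w b * bspline (Xi l i) (p i) k (y b) = (k == be.2 i)%:R].
  apply: bspline_dual => //; first by rewrite -b1; exact: bx.
  by rewrite ltnS; exact: leq_bigmax.
pose Y (u : {ffun 'I_d -> 'I_N}) : 'rV[R]_d := \row_i y i (u i).
have : \sum_(u : {ffun 'I_d -> 'I_N}) (\prod_i w i (u i)) *
    \sum_(be' \in tbasis p Xi l) D be' * tb be' (Y u) = 0.
  apply: big1 => u _; rewrite D0 ?mulr0// => i; rewrite mxE; have [h1 h2 _] := wyP i => //.
under eq_bigr do rewrite (fsbig_finite _ _ (finite_tbasis l)) mulr_sumr.
rewrite exchange_big/=.
have E be' : be' \in fset_set (tbasis p Xi l) ->
    \sum_(u : {ffun 'I_d -> 'I_N}) (\prod_i w i (u i)) * (D be' * tb be' (Y u))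
      = D be' * (be' == be)%:R.
  rewrite in_fset_set; last exact: finite_tbasis.
  move=> /set_mem[b'1 _].
  transitivity (D be' * \sum_(u : {ffun 'I_d -> 'I_N})
      \prod_i (w i (u i) * bspline (Xi l i) (p i) (be'.2 i) (y i (u i)))).
    rewrite mulr_sumr; apply: eq_bigr => u _; rewrite mulrCA.
    rewrite /tbspline b'1 -big_split/=; congr (_ * _); apply: eq_bigr => i _.
    by rewrite mxE.
  congr (_ * _); rewrite -(bigA_distr_bigA (fun i b => w i b * bspline (Xi l i) (p i) (be'.2 i) (y i b))).
  under eq_bigr => i _ do (have [_ _ ->] := wyP i).
  have [->|nb] := eqVneq be' be; first by rewrite big1// => i _; rewrite eqxx.
  have [i bi] : exists i, be'.2 i != be.2 i.
    apply/existsP; rewrite -negb_forall; apply: contra nb => /forallP h.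
    rewrite [be']surjective_pairing [be]surjective_pairing b'1 b1; apply/eqP.
    by congr pair; apply/ffunP => i; exact/eqP.
  by rewrite (bigD1 i)//= (negPf bi) mul0r.
rewrite (eq_big_seq _ E).
rewrite -(fsbig_finite _ _ (finite_tbasis l)).
rewrite (fsbigD1 be _ _ (finite_tbasis l) bl) eqxx mulr1 fsbig1.
  by rewrite /= addr0.
by move=> be' [_ /= /eqP/negPf ->]; rewrite mulr0.
Qed.

End tensor_product.

(** * Hierarchical bases *)

Section hierarchical_basis.
Context (R : realType) (d : nat).
Variables (p : 'I_d -> nat) (Xi : nat -> 'I_d -> seq R).
Hypothesis Xi_open : forall l i, open_knot_vector (p i) (Xi l i).
Variable cf : label d -> label d -> R.
Hypothesis cfP : two_scale p Xi cf.
Implicit Types (be : label d) (x : 'rV[R]_d) (Om : nat -> set 'rV[R]_d).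
Local Notation tb := (tbspline p Xi).
Local Notation hb := (hbasis_rec p Xi cf).

Lemma hbasis_tbasis Om k be : hb Om k be -> (be.1 <= k)%N /\ tbasis p Xi be.1 be.
Proof.
elim: k be => [|k IH] be /=; first by move=> /[dup] -[b0 _]; rewrite b0.
move=> [[/IH[h1 h2] _]|[be0 [/IH[h1 h2] _] [b _]]]; first by split=> //; lia.
by have [b1 _] := b; rewrite b1; split=> //; lia.
Qed.

Lemma finite_hbasis Om k : finite_set (hb Om k).
Proof.
elim: k => [|k IH] /=; first exact: finite_tbasis.
rewrite finite_setU; split; first by apply: sub_finite_set IH => b [].
apply: bigcup_finite; first by apply: sub_finite_set IH => b [].
move=> b _; apply: sub_finite_set (finite_tbasis p Xi b.1.+1).
by move=> b' [].
Qed.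

(** Nonnegative two-scale coefficients rule out cancellation: where a child is positive, so is its
    parent. *)
Lemma child_supp be0 be : tbasis p Xi be0.1 be0 -> children p Xi cf be0 be ->
  supp p Xi be `<=` supp p Xi be0.
Proof.
move=> b0 [b cn0]; apply: closureS => x /= bx.
have [c0 ts] := cfP b0; rewrite ts; last exact: tbspline_cube bx.
rewrite (fsbigD1 be _ _ (finite_tbasis p Xi _) b) gt_eqF//.
have tb0 be' y : tbasis p Xi be0.1.+1 be' -> 0 <= tb be' y by exact: tbspline_ge0.
apply: ltr_pwDl; last by apply: fsumr_ge0 => i [bi _]; rewrite mulr_ge0 ?c0 ?tb0.
by rewrite mulr_gt0// lt_neqAle eq_sym ?cn0 ?bx ?c0 ?tb0.
Qed.

(** * Levels and supports in a hierarchical basis *)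

Section nested_domains.
Variables (n : nat) (Om : nat -> set 'rV[R]_d).
Hypothesis Om_sub : forall l, (l < n)%N -> Om l.+1 `<=` Om l.

Lemma domains_sub i j : (i <= j <= n)%N -> Om j `<=` Om i.
Proof.
elim: j => [|j IH] h; first by have -> : i = 0%N by lia.
have [->//|ij] := eqVneq i j.+1.
by apply: subset_trans (IH _); [apply: Om_sub|]; lia.
Qed.

(** A function of level l is tested against [Om l.+1] in the step following its creation. If it
    survives, its support lies in no later, smaller domain either, so it is never refined; in
    particular step [k.+1] creates only functions of level [k.+1]. *)
Lemma hbasis_not_sub k be : (k <= n)%N -> hb Om k be -> (be.1 < k)%N ->
  ~ supp p Xi be `<=` Om be.1.+1.
Proof.
elim: k be => // k IH be kn [[hk ns] lk|[be0 [hk s0] [[b1 _] _]] lk].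
  have [bk|bk] := eqVneq be.1 k; first by rewrite bk.
  by apply: IH => //; lia.
have bk : (be0.1 < k)%N by lia.
exfalso; apply: (IH be0 _ hk bk); first by lia.
by apply: subset_trans s0 (domains_sub _); lia.
Qed.

Lemma hbasis_refined_level k be : (k < n)%N -> hb Om k be ->
  supp p Xi be `<=` Om k.+1 -> be.1 = k.
Proof.
move=> kn hk s; have [bk _] := hbasis_tbasis hk.
apply/eqP; rewrite eqn_leq bk leqNgt; apply/negP => lt.
apply: (hbasis_not_sub _ hk lt); first by lia.
by apply: subset_trans s (domains_sub _); lia.
Qed.

(** A function of positive level l was created as a child of a function of level l-1 whose support
    lay in [Om l], and supports of children only shrink. *)
Lemma hbasis_supp_sub k be : (k <= n)%N -> hb Om k be -> (0 < be.1)%N ->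
  supp p Xi be `<=` Om be.1.
Proof.
elim: k be => [|k IH] be kn; first by case=> ->.
move=> [[hk ns] b0|[be0 [hk s0] ch] b0]; first by apply: IH => //; lia.
have b0k := hbasis_refined_level kn hk s0.
have [[be1 _] _] := ch; rewrite be1 b0k.
apply: subset_trans s0; apply: child_supp => //.
by have [] := hbasis_tbasis hk.
Qed.

End nested_domains.

Lemma hierarchy_gt0 n Om : hierarchy Xi n Om -> (0 < n)%N.
Proof.
case: n => [|//] [Om0 Om0' _ _]; exfalso.
have : @cube R d 0 by move=> i; rewrite mxE lexx ler01.
by rewrite -Om0 Om0'.
Qed.

Lemma hierarchy_closed n Om l : hierarchy Xi n Om -> (l < n)%N -> closed (Om l.+1).
Proof.
move=> [_ On _ Omu] ln; have [->|nl] := eqVneq l.+1 n.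
  by rewrite On; exact: closed0.
have [|C CM ->] := Omu l.+1; first by lia.
apply: closed_bigcup; first exact: sub_finite_set CM (finite_mesh Xi l).
by move=> Q /CM; exact: closed_mesh.
Qed.

(** Induction on the level of [be]. Near a point outside the domain of the next level, terms of
    larger levels vanish by their supports and terms of smaller levels by induction, so local
    independence within one level applies. The conclusion is a product, which spares a proof that no
    basis function is identically zero. *)
Lemma hbasis_independence n Om (D : label d -> R) : hierarchy Xi n Om ->
  (forall x, cube x -> \sum_(be \in hbasis p Xi cf n Om) D be * tb be x = 0) ->
  forall be x, hbasis p Xi cf n Om be -> D be * tb be x = 0.
Proof.
move=> hOm D0 be x; rewrite /hbasis in D0 *.
have n0 := hierarchy_gt0 hOm; have [_ On Om_sub _] := hOm.
have [l] := ubnP be.1; elim: l be x => // l IH be x bl Hbe.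
have [->|bx] := eqVneq (tb be x) 0; first by rewrite mulr0.
suff -> : D be = 0 by rewrite mul0r.
have [bn tbe] := hbasis_tbasis Hbe.
(* At the top level the next domain is empty. Below it, the next domain is closed, so if it
   contained all points where [be] is nonzero it would contain the support. *)
have {x bx} [x bx xO] : exists2 x, tb be x != 0 & ~ Om be.1.+1 x.
  have [bn1|bn1] := eqVneq be.1 n.-1.
    by exists x => //; rewrite bn1 prednK// On.
  apply: contrapT => h; apply: (hbasis_not_sub Om_sub _ Hbe); [lia|lia|].
  have /closure_id -> : closed (Om be.1.+1) by apply: (hierarchy_closed hOm); lia.
  apply: closureS => y /= yb; apply: contrapT => yO; apply: h.
  by exists y.
have /nbhs_ballP[e /= e0 eO] : nbhs x (~` Om be.1.+1).
  apply: open_nbhs_nbhs; split => //; rewrite openC.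
  by apply: (hierarchy_closed hOm); lia.
(* Extension by 0 to the whole basis of the level, to which local independence applies. *)
pose D' b := if b \in hb Om n.-1 then D b else 0.
have -> : D be = D' be by rewrite /D' mem_set.
apply: (tbspline_local_independence Xi_open e0 tbe bx) => y cy yx.
have yO : ~ Om be.1.+1 y.
  by apply: eO; split => // i j; rewrite ord1 /ball/= distrC.
rewrite -[RHS](D0 y cy).
transitivity (\sum_(b \in tbasis p Xi be.1 `&` hb Om n.-1) D b * tb b y).
  rewrite [RHS]fsbig_mkcondr /=; apply: eq_fsbigr => b _; rewrite /D'.
  by case: ifP; rewrite ?mul0r.
have Z (b : label d) : hb Om n.-1 b -> b.1 <> be.1 -> D b * tb b y = 0.
  move=> Hb /eqP; have [bn' tbb] := hbasis_tbasis Hb.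
  rewrite neq_ltn => /orP[lt|lt]; first by apply: IH => //; exact: leq_trans lt bl.
  have [->|by0] := eqVneq (tb b y) 0; first by rewrite mulr0.
  exfalso; apply: yO; apply: (domains_sub Om_sub (j := b.1)); first by lia.
  by apply: (hbasis_supp_sub Om_sub _ Hb); [lia|lia|exact: tbspline_supp].
apply: fsbig_widen; first by move=> b [].
move=> b [Hb nb]; have [_ tbb] := hbasis_tbasis Hb.
by apply: Z => // bb; apply: nb; split => //; rewrite -bb.
Qed.

(** The strict inequality of levels, for functions outside [H], is the source of the factor
    1/q^2. *)
Definition decomposes (H : set (label d)) be (C : label d -> R) : Prop :=
  [/\ forall b, H b -> 0 <= C b,
      forall b, H b -> C b != 0 -> (be.1 <= b.1)%N /\ (~ H be -> (be.1 < b.1)%N) &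
      forall x, cube x -> tb be x = \sum_(b \in H) C b * tb b x].

Lemma decomposes_self H be : finite_set H -> H be ->
  decomposes H be (fun b => (b == be)%:R).
Proof.
move=> fH Hbe; split => [b _|b _|x _]; first by case: eqP.
  by have [->|_] := eqVneq b be; [|rewrite eqxx].
rewrite (fsbigD1 be _ _ fH Hbe) eqxx mul1r fsbig1 /= ?addr0//.
by move=> b [_ /= /eqP/negPf->]; rewrite mul0r.
Qed.

Lemma decomposes_children Om k be : hb Om k be -> supp p Xi be `<=` Om k.+1 ->
  decomposes (hb Om k.+1) be
    (fun b => if b \in children p Xi cf be then cf be b else 0).
Proof.
move=> Hbe s; have [_ tbe] := hbasis_tbasis Hbe; have [c0 ts] := cfP tbe.
split.
- by move=> b _; case: ifPn => // /set_mem[tb' _]; exact: c0.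
- move=> b _; case: ifPn => [|_]; last by rewrite eqxx.
  by move=> /set_mem[[b1 _] _] _; rewrite b1.
- move=> x cx; rewrite ts//.
  transitivity (\sum_(b \in children p Xi cf be) cf be b * tb b x).
    apply/esym/fsbig_widen; first by move=> b [].
    move=> b [tb' nb]; rewrite /preimage/=; have [->|cn] := eqVneq (cf be b) 0.
      by rewrite mul0r.
    by exfalso; apply: nb.
  rewrite -[RHS](@fsbig_widen _ _ _ _ (children p Xi cf be)).
  + by apply: eq_fsbigr => b bc; rewrite bc.
  + by move=> b bc; right; exists be.
  + by move=> b [_ nb]; rewrite /preimage/= memNset// mul0r.
Qed.

(** Each function of the old basis is either kept or replaced by its children; these decompositions
    are substituted in the given one. The case split secures strictness for [be] outside the new
    basis: either [be] has just been refined and its children have a larger level, or it was already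
    absent and strictness is inherited from [C]. *)
Lemma decomposes_refine Om k be C : decomposes (hb Om k) be C ->
  exists C', decomposes (hb Om k.+1) be C'.
Proof.
move=> [C0 Cl Cs].
have [Hbe1|Hbe1] := pselect (hb Om k.+1 be).
  by eexists; exact/decomposes_self/Hbe1/finite_hbasis.
have [Hbe|Hbe] := pselect (hb Om k be).
  have [s|ns] := pselect (supp p Xi be `<=` Om k.+1).
    by eexists; exact: decomposes_children.
  by exfalso; apply: Hbe1; left.
have /choice[E HE] b : exists E, hb Om k b -> decomposes (hb Om k.+1) b E.
  have [Hb|] := pselect (hb Om k b); last by exists (fun=> 0).
  have [s|ns] := pselect (supp p Xi b `<=` Om k.+1).
    by eexists => _; exact: decomposes_children.
  by eexists => _; apply: decomposes_self; [exact: finite_hbasis|left].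
exists (fun b' => \sum_(b \in hb Om k) C b * E b b'); split.
- move=> b' Hb'; apply: fsumr_ge0 => b Hb.
  by have [e0 _ _] := HE b Hb; rewrite mulr_ge0 ?C0 ?e0.
- move=> b' Hb' n0.
  have [b Hb cb] : exists2 b, hb Om k b & C b * E b b' != 0.
    apply: contrapT => h; move/eqP: n0; apply; apply: fsbig1 => b Hb.
    by apply/eqP/negPn/negP => cb; apply: h; exists b.
  move: cb; rewrite mulf_eq0 negb_or => /andP[cb eb].
  have [_ el _] := HE b Hb; have [bb' _] := el b' Hb' eb.
  have [bb lbb] := Cl b Hb cb; split; first exact: leq_trans bb bb'.
  by move=> _; exact: leq_trans (lbb Hbe) bb'.
- move=> x cx; rewrite Cs//.
  transitivity (\sum_(b \in hb Om k) \sum_(b' \in hb Om k.+1) C b * (E b b' * tb b' x)).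
    apply: eq_fsbigr => b /set_mem Hb; have [_ _ es] := HE b Hb.
    by rewrite es// mulr_fsumr.
  rewrite exchange_fsbig; [|exact: finite_hbasis|exact: finite_hbasis].
  by apply: eq_fsbigr => b' _; rewrite mulr_fsuml; under eq_fsbigr do rewrite mulrA.
Qed.

(** * Comparison of a basis with that of an enlarged hierarchy *)

Section enlarged_domains.
Variables (n : nat) (Om Oms : nat -> set 'rV[R]_d).
Hypothesis Om_sub : forall l, (l < n)%N -> Om l.+1 `<=` Om l.
Hypothesis Om_Oms : forall l, (1 <= l <= n)%N -> Om l `<=` Oms l.

(** The parent of a function of top level has its support in [Om k], hence in [Oms k], so it is
    refined in the enlarged hierarchy as well. *)
Lemma hbasis_top_level k be : (k <= n)%N -> hb Om k be -> be.1 = k -> hb Oms k be.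
Proof.
elim: k be => // k IH be kn [[hk _] bk|[be0 [hk s0] ch] bk].
  by have [] := hbasis_tbasis hk; lia.
right; exists be0 => //; split.
  by apply: IH => //; [lia|have [[? _] _] := ch; lia].
by apply: subset_trans s0 (Om_Oms _); lia.
Qed.

(** A kept function is handled by induction and one more refinement; a newly created one has top
    level and therefore belongs to the enlarged basis itself. *)
Lemma hbasis_decomposes k be : (k <= n)%N -> hb Om k be ->
  exists C, decomposes (hb Oms k) be C.
Proof.
elim: k be => [|k IH] be kn.
  move=> Hbe; eexists; apply: decomposes_self; last exact: Hbe.
  exact: (finite_hbasis Oms 0).
move=> Hbe; case: (Hbe) => [[hk _]|[be0 [hk s0] ch]].
  by have [|C /decomposes_refine] := IH be _ hk; first by lia.
have [[b1 _] _] := ch.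
eexists; apply: decomposes_self; first exact: finite_hbasis.
apply: hbasis_top_level => //.
by rewrite b1 (hbasis_refined_level Om_sub kn hk s0).
Qed.

End enlarged_domains.

End hierarchical_basis.

(** * Measurability and one-sided Lipschitz bounds *)

Section measure_rV.
Context (R : realType) (d : nat).
Local Notation leb := (lebesgue_rV R d).

Lemma measurable_box (a b : 'I_d -> R) :
  measurable [set x : 'rV[R]_d | forall i, a i < x 0 i < b i].
Proof.
rewrite (_ : mkset _ = \bigcap_(i in [set: 'I_d])
    (@coord_rV R d i @^-1` `]a i, b i[%classic)).
  apply: fin_bigcap_measurable; first exact: finite_finset.
  move=> i _; rewrite -[X in measurable X]setTI.
  by apply: measurable_coord_rV => //; exact: measurable_itv.
apply/seteqP; split=> x /= h i.
  by move=> _; rewrite /preimage/= in_itv/=; exact: h.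
by have := h i Logic.I; rewrite /= in_itv.
Qed.

(** An open set is the union of the countably many rational boxes that it contains. *)
Lemma open_measurable_rV (U : set 'rV[R]_d) : open U -> measurable U.
Proof.
move=> oU.
pose box (u : {ffun 'I_d -> rat * rat}) :=
  [set x : 'rV[R]_d | forall i, ratr (u i).1 < x 0 i < ratr (u i).2].
have -> : U = \bigcup_u (if `[< box u `<=` U >] then box u else set0).
  apply/seteqP; split=> x; last by move=> [u _]; case: ifPn => // /asboolP; apply.
  move=> Ux; have /nbhs_ballP[e /= e0 eU] : nbhs x U by exact: open_nbhs_nbhs.
  have /choice[u hu] i : exists u : rat * rat,
      [/\ x 0 i - e < ratr u.1, ratr u.1 < x 0 i, x 0 i < ratr u.2 &
          ratr u.2 < x 0 i + e].
    have [|r1 /itvP r1x] := @rat_in_itvoo R (x 0 i - e) (x 0 i); first by lra.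
    have [|r2 /itvP r2x] := @rat_in_itvoo R (x 0 i) (x 0 i + e); first by lra.
    by exists (r1, r2); rewrite /= !r1x !r2x.
  exists (finfun u) => //; have -> : `[< box (finfun u) `<=` U >].
    apply/asboolP => y by_; apply: eU; split => // i j.
    rewrite ord1 /ball/= ltr_norml; have := by_ j; rewrite ffunE.
    by have [? ? ? ?] := hu j; lra.
  by move=> i; rewrite ffunE; have [? -> -> ?] := hu i.
apply: countable_bigcupT_measurable; first exact: countableP.
move=> u; case: ifP => _ //.
exact: measurable_box.
Qed.

Lemma measurable_cube : measurable (@cube R d).
Proof.
rewrite (_ : @cube R d = \bigcap_(i in [set: 'I_d])
    (@coord_rV R d i @^-1` `[0, 1]%classic)).
  apply: fin_bigcap_measurable; first exact: finite_finset.
  move=> i _; rewrite -[X in measurable X]setTI.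
  by apply: measurable_coord_rV => //; exact: measurable_itv.
apply/seteqP; split=> x /= h i.
  by move=> _; rewrite /preimage/= in_itv/=; exact: h.
by have := h i Logic.I; rewrite /= in_itv.
Qed.

End measure_rV.

Lemma lebesgue_cube_lty (R : realType) d : (lebesgue_rV R d (@cube R d) < +oo)%E.
Proof.
elim: d => [|d IH]; first by rewrite /= diracE ltry.
rewrite /= /lebesgue_rV_step /= /pushforward.
rewrite (_ : _ @^-1` _ = `[0, 1]%classic `*` @cube R d).
  rewrite product_measure1E //; last exact: measurable_cube.
  rewrite lte_mul_pinfty//.
  change (@lebesgue_measure R `[0, 1]%classic \is a fin_num).
  by rewrite lebesgue_measure_itv/= lte_fin ltr01 oppr0 adde0.
apply/seteqP; split => -[t x] /=.
  move=> h; split; first by have := h ord0; rewrite mxE unlift_none /= in_itv.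
  by move=> i; have := h (lift ord0 i); rewrite mxE liftK.
rewrite in_itv/= => -[t01 h] i; rewrite mxE.
by case: (unliftP ord0 i) => [j|] _ //=; exact: h.
Qed.

Section right_lipschitz.
Context (R : realType) (d : nat).
Implicit Types (x : 'rV[R]_d) (f g : 'rV[R]_d -> R).
Variable i : 'I_d.

(* B-splines are not differentiable at the knots, but they satisfy this one-sided
   condition everywhere, which bounds their derivatives wherever these exist. *)
Definition right_lipschitz f : Prop := exists M : R,
  [/\ 0 <= M, forall x, cube x -> `|f x| <= M &
   forall x, (forall j, 0 <= x 0 j < 1) ->
     \forall t \near 0^'+, `|f (t *: unit_vec R i + x) - f x| <= M * t].

Lemma unit_vecE (t : R) x j : (t *: unit_vec R i + x) 0 j = t * (j == i)%:R + x 0 j.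
Proof. by rewrite !mxE eqxx. Qed.

Lemma near_cube x : (forall j, 0 <= x 0 j < 1) ->
  \forall t \near 0^'+, cube (t *: unit_vec R i + x).
Proof.
move=> x01; have /andP[x0 x1] := x01 i.
near=> t; have t0 : 0 < t by near: t; exact: nbhs_right_gt.
have t1 : t < 1 - x 0 i by near: t; apply: nbhs_right_lt; rewrite subr_gt0.
move=> j; rewrite unit_vecE; have /andP[? ?] := x01 j.
by have [->|_] := eqVneq j i; rewrite ?mulr1 ?mulr0; lra.
Unshelve. all: by end_near. Qed.

Lemma cube_half x : (forall j, 0 <= x 0 j < 1) -> cube x.
Proof. by move=> h j; have /andP[-> /ltW ->] := h j. Qed.

Lemma right_lipschitz_cst (a : R) : right_lipschitz (cst a).
Proof.
exists `|a|; split=> // x _; near=> t.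
by rewrite subrr normr0 mulr_ge0// ltW//; near: t; exact: nbhs_right_gt.
Unshelve. all: by end_near. Qed.

Lemma right_lipschitz_coord j : right_lipschitz (fun x => x 0 j).
Proof.
exists 1; split=> // x hx; first by rewrite ler_norml; have := hx j; lra.
near=> t; have t0 : 0 < t by near: t; exact: nbhs_right_gt.
rewrite unit_vecE addrK mul1r normrM (gtr0_norm t0).
by case: eqP; rewrite ?normr1 ?normr0; lra.
Unshelve. all: by end_near. Qed.

Lemma right_lipschitzD f g : right_lipschitz f -> right_lipschitz g ->
  right_lipschitz (fun x => f x + g x).
Proof.
move=> [M [M0 fM flip]] [N [N0 gN glip]]; exists (M + N); split.
- by rewrite addr_ge0.
- by move=> x cx; rewrite (le_trans (ler_normD _ _))// lerD ?fM ?gN.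
move=> x x01; near=> t.
have ft : `|f (t *: unit_vec R i + x) - f x| <= M * t by near: t; exact: flip.
have gt : `|g (t *: unit_vec R i + x) - g x| <= N * t by near: t; exact: glip.
by rewrite opprD addrACA (le_trans (ler_normD _ _))// mulrDl lerD.
Unshelve. all: by end_near. Qed.

Lemma right_lipschitzM f g : right_lipschitz f -> right_lipschitz g ->
  right_lipschitz (fun x => f x * g x).
Proof.
(* One constant has to dominate both the bound M N of the product and its one-sided Lipschitz
   constant 2 M N. *)
move=> [M [M0 fM flip]] [N [N0 gN glip]]; exists (M * N + (M * N + M * N)); split.
- by rewrite !addr_ge0 ?mulr_ge0.
- move=> x cx; rewrite normrM (@le_trans _ _ (M * N))// ?ler_pM ?fM ?gN//.
  by rewrite lerDl addr_ge0 ?mulr_ge0.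
move=> x x01; near=> t.
have ft : `|f (t *: unit_vec R i + x) - f x| <= M * t by near: t; exact: flip.
have gt : `|g (t *: unit_vec R i + x) - g x| <= N * t by near: t; exact: glip.
have ct : cube (t *: unit_vec R i + x) by near: t; exact: near_cube.
have t0 : 0 < t by near: t; exact: nbhs_right_gt.
set y := _ + x in ft gt ct *.
have -> : f y * g y - f x * g x = (f y - f x) * g y + f x * (g y - g x) by ring.
rewrite (le_trans (ler_normD _ _))// !normrM.
rewrite (@le_trans _ _ (M * t * N + M * (N * t)))//.
  by rewrite lerD// ler_pM// ?fM ?gN//; exact: cube_half.
have : 0 <= M * N * t by rewrite !mulr_ge0// ltW.
by rewrite !mulrDl; lra.
Unshelve. all: by end_near. Qed.

Lemma right_lipschitz_prod (I : Type) (s : seq I) (F : I -> 'rV[R]_d -> R) :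
  (forall k, right_lipschitz (F k)) -> right_lipschitz (fun x => \prod_(k <- s) F k x).
Proof.
move=> h; elim: s => [|k s IH].
  by under [X in right_lipschitz X]eq_fun do rewrite big_nil; exact: right_lipschitz_cst.
by under [X in right_lipschitz X]eq_fun do rewrite big_cons; exact: right_lipschitzM.
Qed.

Lemma right_lipschitz_sum (I : Type) (s : seq I) (F : I -> 'rV[R]_d -> R) :
  (forall k, right_lipschitz (F k)) -> right_lipschitz (fun x => \sum_(k <- s) F k x).
Proof.
move=> h; elim: s => [|k s IH].
  by under [X in right_lipschitz X]eq_fun do rewrite big_nil; exact: right_lipschitz_cst.
by under [X in right_lipschitz X]eq_fun do rewrite big_cons; exact: right_lipschitzD.
Qed.

(** In degree 0, spans are closed on the left and open on the right, so the value does not change on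
    a short step to the right from a coordinate below 1. The recursion then only multiplies by
    affine functions and adds. *)
Lemma right_lipschitz_bspline Xi k m j :
  right_lipschitz (fun x => bspline Xi k m (x 0 j)).
Proof.
elim: k m => [|k IH] m /=.
  exists 1; split=> // [x _|x x01]; first by case: (_ || _); rewrite ?normr1 ?normr0.
  have /andP[x0 x1] := x01 j.
  have gap (a : R) : \forall t \near 0^'+, x 0 j < a -> x 0 j + t < a.
    have [xa|ax] := ltP (x 0 j) a; last by apply: nearW.
    by near=> u; rewrite -ltrBrDl => _; near: u; apply: nbhs_right_lt; lra.
  near=> t.
  have t0 : 0 < t by near: t; exact: nbhs_right_gt.
  have t1 : t < 1 - x 0 j by near: t; apply: nbhs_right_lt; lra.
  suff -> : ((Xi`_m <= (t *: unit_vec R i + x) 0 j < Xi`_m.+1) ||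
     [&& (t *: unit_vec R i + x) 0 j == 1, Xi`_m < 1 & Xi`_m.+1 == 1]) =
     ((Xi`_m <= x 0 j < Xi`_m.+1) || [&& x 0 j == 1, Xi`_m < 1 & Xi`_m.+1 == 1]).
    by rewrite subrr normr0; lra.
  have g1 : x 0 j < Xi`_m -> x 0 j + t < Xi`_m by near: t; exact: gap.
  have g2 : x 0 j < Xi`_m.+1 -> x 0 j + t < Xi`_m.+1 by near: t; exact: gap.
  rewrite unit_vecE; have [_|_] := eqVneq j i; last by rewrite mulr0 add0r.
  rewrite mulr1 (lt_eqF x1) (_ : (t + x 0 j == 1) = false) ?orbF; last by lra.
  by apply/andP/andP => -[? ?]; split; lra.
have lin1 a c : right_lipschitz (fun x => (x 0 j - a) / c).
  apply: right_lipschitzM; last exact: right_lipschitz_cst.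
  by apply: right_lipschitzD; [exact: right_lipschitz_coord|exact: right_lipschitz_cst].
have lin2 a c : right_lipschitz (fun x => (a - x 0 j) / c).
  rewrite (_ : (fun x => _) = fun x => (x 0 j - a) / - c) //.
  by apply/funext => x; rewrite invrN mulrN -mulNr opprB.
by apply: right_lipschitzD; exact: right_lipschitzM.
Unshelve. all: by end_near. Qed.

End right_lipschitz.

Section measurable_splines.
Context (R : realType).

Lemma measurable_bspline (Xi : seq R) k j :
  measurable_fun [set: measurableTypeR R] (bspline Xi k j : measurableTypeR R -> R).
Proof.
elim: k j => [|k IH] j.
  pose A : set (measurableTypeR R) := `[Xi`_j, Xi`_j.+1[%classic `|`
    (if (Xi`_j < 1) && (Xi`_j.+1 == 1) then [set 1] else set0).
  rewrite (_ : bspline Xi 0 j = \1_A).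
    apply/measurable_indicP; apply: measurableU; first exact: measurable_itv.
    by case: ifP => _.
  apply/funext => x /=; rewrite indicE; congr (nat_of_bool _)%:R.
  apply/idP/idP => [h|/set_mem].
    apply/mem_set; case/orP: h => [h|/and3P[/eqP x1 l1 l2]]; last by right; rewrite l1 l2.
    by left; rewrite /= in_itv.
  move=> [|]; first by rewrite /= in_itv => ->.
  by case: ifP => [/andP[l1 l2] /= ->|_ []]; rewrite eqxx orbT.
have lin a c : measurable_fun [set: measurableTypeR R] (fun x : R => (x - a) / c).
  by apply: measurable_funM => //; apply: measurable_funB.
have lin2 a c : measurable_fun [set: measurableTypeR R] (fun x : R => (a - x) / c).
  by apply: measurable_funM => //; apply: measurable_funB.
by apply: measurable_funD; apply: measurable_funM => //; exact: IH.
Qed.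

Lemma measurable_tbspline d (p : 'I_d -> nat) (Xi : nat -> 'I_d -> seq R) be :
  measurable_fun [set: 'rV[R]_d] (tbspline p Xi be).
Proof.
rewrite /tbspline; apply: measurable_prod => i _.
apply: (measurableT_comp (measurable_bspline _ _ _)).
exact: (@measurable_coord_rV R d i).
Qed.

Lemma measurable_hspan d p (Xi : nat -> 'I_d -> seq R) (H : set (label d)) V :
  finite_set H -> hspan p Xi H V -> measurable_fun [set: 'rV[R]_d] V.
Proof.
move=> fH [cV ->]; under eq_fun do rewrite (fsbig_finite _ _ fH).
apply: measurable_sum => be; apply: measurable_funM => //.
exact: measurable_tbspline.
Qed.

Lemma right_lipschitz_hspan d i p (Xi : nat -> 'I_d -> seq R) (H : set (label d)) V :
  finite_set H -> hspan p Xi H V -> right_lipschitz i V.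
Proof.
move=> fH [cV ->]; under [X in right_lipschitz _ X]eq_fun do rewrite (fsbig_finite _ _ fH).
apply: right_lipschitz_sum => be; apply: right_lipschitzM; first exact: right_lipschitz_cst.
by apply: right_lipschitz_prod => j; exact: right_lipschitz_bspline.
Qed.

End measurable_splines.

(** * Derivatives on the regular set *)

Section regular_gradient.
Context (R : realType) (d : nat).
Implicit Types (V P : 'rV[R]_d -> R) (x v : 'rV[R]_d).

Lemma polynomial_derivable P x v : polynomial_fun P -> derivable P x v.
Proof.
move=> [s Ps]; have -> : P = fun x => \sum_(m <- s) m.1 * \prod_i x 0 i ^+ m.2 i.
  exact/funext.
elim: s {Ps} => [|m s IH].
  under [X in derivable X]eq_fun do rewrite big_nil; exact: derivable_cst.
under [X in derivable X]eq_fun do rewrite big_cons.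
apply: derivableD; last exact: IH.
apply: derivableM; first exact: derivable_cst.
elim: (index_enum _) => [|i r IHr].
  under [X in derivable X]eq_fun do rewrite big_nil; exact: derivable_cst.
under [X in derivable X]eq_fun do rewrite big_cons.
apply: derivableM; last exact: IHr.
elim: (m.2 i) => [|k IHk].
  under [X in derivable X]eq_fun do rewrite expr0; exact: derivable_cst.
under [X in derivable X]eq_fun do rewrite exprS.
apply: derivableM; last exact: IHk.
exact/diff_derivable/differentiable_coord.
Qed.

Lemma open_regular_set V : open (regular_set V).
Proof.
apply: openI; first exact: open_interior.
rewrite openE => x [P pP /nbhs_interior h].
by apply: filterS h => y hy; exists P.
Qed.

Lemma regular_set_cube V : regular_set V `<=` @cube R d.
Proof. by move=> x [/interior_subset]. Qed.

Lemma regular_set_lt1 V x : regular_set V x -> forall j, 0 <= x 0 j < 1.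
Proof.
move=> [/[dup] /interior_subset cx /nbhs_ballP[e /= e0 h] _] j.
have /andP[-> _] := cx j.
have /h/(_ j) : ball x e ((e / 2) *: unit_vec R j + x).
  split => // k l; rewrite ord1 /ball/= unit_vecE opprD addrCA subrr addr0 normrN.
  by rewrite normrM ger0_norm ?divr_ge0 ?ltW//; case: eqP; rewrite ?normr1 ?normr0; lra.
by rewrite unit_vecE eqxx mulr1; lra.
Qed.

(** The steps 1/(k+1) form a sequence, so that measurability passes to the limit, and they are
    positive, so that one-sided Lipschitz bounds apply. *)
Definition diff_quotient V v (k : nat) x : R :=
  k.+1%:R * (V (k.+1%:R^-1 *: v + x) - V x).

Lemma harmonic_cvg_at_right : (fun k : nat => k.+1%:R^-1 : R) @ \oo --> 0^'+.
Proof.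
move=> A [e /= e0 eA].
have : (fun k : nat => k.+1%:R^-1 : R) @ \oo --> 0 by exact: cvg_harmonic.
move=> /cvgrPdist_lt/(_ e e0) H.
suff : \forall k \near \oo, A (k.+1%:R^-1 : R) by [].
near=> k; apply: eA.
  by rewrite /ball/=; near: k; exact: H.
by have : (0 : R) < k.+1%:R^-1 by rewrite invr_gt0.
Unshelve. all: by end_near. Qed.

Lemma cvg_diff_quotient V v x : regular_set V x ->
  diff_quotient V v ^~ x @ \oo --> 'D_v V x.
Proof.
move=> [_ [P pP VP]].
have dV : derivable V x v.
  have PV : {near x, P =1 V} by apply: filterS VP => y.
  have := near_eq_derivable PV; apply; exact: polynomial_derivable.
have h0 : (fun k : nat => k.+1%:R^-1 : R) @ \oo --> 0^'.
  move=> A hA; apply: harmonic_cvg_at_right; move: hA.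
  by apply: (@filterS _ (nbhs (0 : R))) => y h y0; apply: h; rewrite gt_eqF.
have := cvg_comp _ _ h0 dV; apply: cvg_trans.
apply: near_eq_cvg; near=> k.
by rewrite /diff_quotient /= invrK.
Unshelve. all: by end_near. Qed.

Lemma measurable_partial V i : measurable_fun [set: 'rV[R]_d] V ->
  measurable_fun (regular_set V) (fun x => 'D_(unit_vec R i) V x).
Proof.
move=> mV; apply: (@measurable_fun_cvg _ _ _ _ (diff_quotient V (unit_vec R i))).
  move=> k; apply: measurable_funTS; apply: measurable_funM => //.
  apply: measurable_funB => //; apply: measurableT_comp => //.
  apply: measurable_fun_rVP => j; rewrite /comp /coord_rV.
  under eq_fun do rewrite unit_vecE.
  by apply: measurable_funD => //; exact: (@measurable_coord_rV R d j).
by move=> x Ux; exact: cvg_diff_quotient.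
Qed.

Lemma bounded_partial V i : right_lipschitz i V ->
  exists M, forall x, regular_set V x -> `|'D_(unit_vec R i) V x| <= M.
Proof.
move=> [M [M0 _ lip]]; exists M => x Ux.
have /cvg_norm D := cvg_diff_quotient (v := unit_vec R i) Ux.
apply: (cvgr_to_le D).
have /harmonic_cvg_at_right := lip x (regular_set_lt1 Ux).
move=> H; near=> k; rewrite /diff_quotient normrM ger0_norm//.
by rewrite mulrC -ler_pdivlMr//; near: k; exact: H.
Unshelve. all: by end_near. Qed.

End regular_gradient.

(** * Square integrability of the residual *)

Section ess_bounded.
Context d (T : measurableType d) (R : realType).
Variable mu : {measure set T -> \bar R}.
Implicit Types u v : T -> R.

Definition ess_bounded u : Prop :=
  measurable_fun setT u /\ exists K, {ae mu, forall x, `|u x| <= K}.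

Lemma Linf_ess_bounded u : u \in Lfun mu +oo%E -> ess_bounded u.
Proof.
move=> Lu; have mu_ : measurable_fun setT u := set_mem (sub_Lfun_mfun Lu).
have h : finite_norm mu +oo u := set_mem (sub_Lfun_finLfun Lu).
(* The norm is defined by cases on whether the whole space has positive measure; if not, every
   property holds almost everywhere. *)
split => //; move: h; rewrite /finite_norm unlock; case: ifPn => [m0|]; last first.
  rewrite -leNgt => m0 _; exists 0; apply: measure0_ae.
  by apply/eqP; rewrite eq_le m0 measure_ge0.
have := ess_sup_ge mu (abse \o (EFin \o u)).
case: (ess_sup _ _) => [r|//|] h _.
  by exists r; apply: filterS h => x; rewrite /= lee_fin.
by exists 0; apply: filterS h => x.
Qed.

Lemma ess_boundedD u v : ess_bounded u -> ess_bounded v ->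
  ess_bounded (fun x => u x + v x).
Proof.
move=> [mu_ [K uK]] [mv [L vL]]; split; first exact: measurable_funD.
exists (K + L); apply: filterS2 uK vL => x ux vx.
by rewrite (le_trans (ler_normD _ _))// lerD.
Qed.

Lemma ess_boundedM u v : ess_bounded u -> ess_bounded v ->
  ess_bounded (fun x => u x * v x).
Proof.
move=> [mu_ [K uK]] [mv [L vL]]; split; first exact: measurable_funM.
exists (K * L); apply: filterS2 uK vL => x ux vx.
by rewrite normrM ler_pM.
Qed.

Lemma ess_boundedN u : ess_bounded u -> ess_bounded (fun x => - u x).
Proof.
move=> [mu_ [K uK]]; split; first exact: measurableT_comp.
by exists K; apply: filterS uK => x; rewrite normrN.
Qed.

Lemma ess_bounded_cst (a : R) : ess_bounded (fun=> a).
Proof. by split => //; exists `|a|; apply: nearW => x. Qed.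

Lemma ess_bounded_sum I (s : seq I) (F : I -> T -> R) :
  (forall i, ess_bounded (F i)) -> ess_bounded (fun x => \sum_(i <- s) F i x).
Proof.
move=> h; elim: s => [|i s IH].
  by under [X in ess_bounded X]eq_fun do rewrite big_nil; exact: ess_bounded_cst.
by under [X in ess_bounded X]eq_fun do rewrite big_cons; exact: ess_boundedD.
Qed.

Lemma ess_bounded_restrict (D : set T) u (M : R) : measurable D ->
  measurable_fun D u -> (forall x, D x -> `|u x| <= M) -> ess_bounded (u \_ D).
Proof.
move=> mD mu_ uM; split; first exact/(measurable_restrictT _ mD).1.
(* [M] can be negative when [D] is empty, whereas the restriction takes the value 0 outside [D]. *)
exists `|M|; apply: nearW => x; rewrite patchE; case: ifPn => [/set_mem Dx|_].
  by rewrite (le_trans (uM x Dx))// ler_norm.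
by rewrite normr0.
Qed.

(** Domination by 2 h^2 + 2 K^2 on [D] and by 2 h^2 elsewhere, with [D] of finite measure. *)
Lemma integrable_sqrD (D : set T) (h g : T -> R) : measurable D -> (mu D < +oo)%E ->
  measurable_fun setT h -> mu.-integrable setT (EFin \o (fun x => h x ^+ 2)) ->
  ess_bounded g -> (forall x, ~ D x -> g x = 0) ->
  mu.-integrable setT (EFin \o (fun x => (h x + g x) ^+ 2)).
Proof.
move=> mD Doo mh ih [mg [K gK]] g0.
have ik : mu.-integrable setT (EFin \o (fun x => 2 * h x ^+ 2 + 2 * K ^+ 2 * \1_D x)).
  have i1 : mu.-integrable setT (EFin \o (fun x => 2 * h x ^+ 2)).
    exact: (integrableZl measurableT 2 ih).
  have i2 : mu.-integrable setT (EFin \o (fun x => 2 * K ^+ 2 * \1_D x)).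
    have iD : mu.-integrable setT (EFin \o (\1_D : T -> R)).
      apply/integrableP; split; first exact/measurable_EFinP/measurable_indicP.
      under eq_integral do rewrite /= ger0_norm//.
      by rewrite integral_indic// setIT.
    exact: (integrableZl measurableT (2 * K ^+ 2) iD).
  exact: (integrableD measurableT i1 i2).
have /integrableP[mk koo] := ik.
have ms : measurable_fun setT (fun x => (h x + g x) ^+ 2).
  by apply: measurable_funX; exact: measurable_funD.
apply/integrableP; split; first exact/measurable_EFinP.
apply: le_lt_trans koo; apply: ae_ge0_le_integral => //.
- by apply: measurableT_comp => //; exact/measurable_EFinP.
- by apply: measurableT_comp => //; exact/measurable_EFinP.
apply: filterS gK => x gx _ /=; rewrite lee_fin ger0_norm ?sqr_ge0//.
have key : (h x + g x) ^+ 2 <= 2 * h x ^+ 2 + 2 * K ^+ 2 * \1_D x.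
  have sq : (h x + g x) ^+ 2 <= 2 * h x ^+ 2 + 2 * g x ^+ 2.
    by rewrite -subr_ge0 (_ : _ - _ = (h x - g x) ^+ 2) ?sqr_ge0//; ring.
  rewrite (le_trans sq)// lerD2l -mulrA ler_pM2l// indicE.
  case: (boolP (x \in D)) => [_|/negP xD] /=.
    by rewrite mulr1 -(ger0_norm (sqr_ge0 (g x))) normrX ler_pXn2r// nnegrE (le_trans _ gx).
  by rewrite g0 ?expr0n/= ?mulr0// => Dx; apply: xD; exact: mem_set.
by rewrite (le_trans key)// ler_norm.
Qed.

End ess_bounded.

Section residual.
Context (R : realType) (d : nat).
Local Notation leb := (lebesgue_rV R d).
Variables (A : 'rV[R]_d -> 'M[R]_d) (b : 'rV[R]_d -> 'rV[R]_d)
  (c f V : 'rV[R]_d -> R).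
Hypothesis d_gt0 : (0 < d)%N.
Hypothesis bP : forall i, Lp_on (@cube R d)° +oo%E (fun x => b x 0 i).
Hypothesis cP : Lp_on (@cube R d) +oo%E c.
Hypothesis fP : Lp_on (@cube R d) 2%:E f.
Hypothesis mV : measurable_fun [set: 'rV[R]_d] V.
Hypothesis lV : forall i, right_lipschitz i V.
Let U := regular_set V.

Lemma residual_measurable_integrable :
  measurable_fun setT (residual A b c f V) /\
  leb.-integrable setT (EFin \o (fun x => residual A b c f V x ^+ 2)).
Proof.
have mU : measurable U by apply: open_measurable_rV; exact: open_regular_set.
pose w := wdiv U (fun y => grad V y *m (A y)^T).
have wb : ess_bounded leb (w \_ U).
  (* Either [wdiv] is a chosen essentially bounded divergence, or there is none and it is the
     default 0. *)
  rewrite /w /wdiv; case: xgetP => [v _ [Lv _]|_].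
    exact: Linf_ess_bounded.
  by apply: (@ess_bounded_restrict _ _ _ _ _ _ 0) => // x _; rewrite normr0.
have Db i : ess_bounded leb ((fun x => 'D_(unit_vec R i) V x) \_ U).
  have [M DM] := bounded_partial (lV i).
  by apply: ess_bounded_restrict DM => //; exact: measurable_partial.
have Vb : ess_bounded leb (V \_ U).
  have [M [_ VM _]] := lV (Ordinal d_gt0).
  apply: (@ess_bounded_restrict _ _ _ _ _ _ M) => //; first exact: measurable_funTS.
  by move=> x Ux; apply: VM; exact: regular_set_cube Ux.
(* The residual splits into the square integrable [h] and the essentially bounded [g]. Each datum is
   restricted to the domain of its own hypothesis; these restrictions disappear on [U], which lies
   in the interior of the cube. *)
pose h := fun x => (f \_ (@cube R d)) x * \1_U x.
pose g := fun x => (w \_ U) x - (\sum_i ((fun x => b x 0 i) \_ (@cube R d)°) x *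
   ((fun x => 'D_(unit_vec R i) V x) \_ U) x) - (c \_ (@cube R d)) x * (V \_ U) x.
have gb : ess_bounded leb g.
  apply: ess_boundedD; first apply: ess_boundedD => //; apply: ess_boundedN.
    by apply: ess_bounded_sum => i; exact: (ess_boundedM (Linf_ess_bounded (bP i)) (Db i)).
  exact: (ess_boundedM (Linf_ess_bounded cP) Vb).
have g0 x : ~ @cube R d x -> g x = 0.
  move=> ncx; have nU : x \in U = false.
    by apply/negbTE/negP => /set_mem/regular_set_cube.
  rewrite /g !patchE nU mulr0 subr0 big1 ?subr0// => i _.
  by rewrite !patchE nU mulr0.
have mf : measurable_fun setT (f \_ (@cube R d)).
  exact: set_mem (sub_Lfun_mfun fP).
have mh : measurable_fun setT h by apply: measurable_funM => //; exact: measurable_indic.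
have ih : leb.-integrable setT (EFin \o (fun x => h x ^+ 2)).
  apply: le_integrable (Lfun2_integrable_sqr fP) => //.
    by apply/measurable_EFinP; exact: measurable_funX.
  move=> x _ /=; rewrite lee_fin !normrX ler_pXn2r ?nnegrE// /h normrM.
  by rewrite ler_piMr// indicE; case: (x \in U); rewrite ?normr1 ?normr0.
have E : residual A b c f V = fun x => h x + g x.
  apply/funext => x; rewrite /residual patchE -/U /h /g indicE.
  case: ifPn => [xU|/negbTE nU]; last first.
    rewrite !patchE nU !mulr0 subr0 big1 ?subr0 ?addr0// => i _.
    by rewrite !patchE nU mulr0.
  have Ux := set_mem xU; have cx := regular_set_cube Ux; have [ix _] := Ux.
  rewrite !patchE xU !(mem_set cx) mulr1 !addrA; congr (_ - _ - _).
  rewrite /dot; apply: eq_bigr => i _.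
  by rewrite !patchE xU (mem_set ix) /grad mxE.
have [mg _] := gb.
rewrite E; split; first exact: measurable_funD.
exact: (integrable_sqrD (@measurable_cube R d) (@lebesgue_cube_lty R d) mh ih gb g0).
Qed.

End residual.

(** * Estimators *)

Section meshsize.
Context (R : realType) (d : nat).
Variable Xi : nat -> 'I_d -> seq R.

(** This includes sets without a supremum, for which [sup] is 0. *)
Lemma sup_ge0 (S : set R) : (forall x, S x -> 0 <= x) -> 0 <= sup S.
Proof.
move=> S0; have [hS|/sup_out->//] := pselect (has_sup S).
have [[x Sx] ub] := hS; exact: le_trans (S0 x Sx) (ub_le_sup ub Sx).
Qed.

Lemma meshsize_ge0 l : 0 <= meshsize Xi l.
Proof.
apply: sup_ge0 => _ [Q _ <-]; apply: sup_ge0 => _ [z _ <-].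
exact: sqrtr_ge0.
Qed.

Lemma meshsize_lt (q : nat) l l' : (1 <= q)%N ->
  (forall l, meshsize Xi l.+1 <= q%:R^-1 * meshsize Xi l) -> (l < l')%N ->
  meshsize Xi l' <= q%:R^-1 * meshsize Xi l.
Proof.
move=> q1 hq; elim: l' => // l' IH; rewrite ltnS leq_eqVlt => /orP[/eqP->//|/IH h].
apply: le_trans (hq l') _; apply: le_trans h.
by rewrite ler_piMl ?meshsize_ge0// invf_le1 ?ltr0n// ler1n.
Qed.

Lemma meshsize_le (q : nat) l l' : (1 <= q)%N ->
  (forall l, meshsize Xi l.+1 <= q%:R^-1 * meshsize Xi l) -> (l <= l')%N ->
  meshsize Xi l' <= meshsize Xi l.
Proof.
move=> q1 hq; rewrite leq_eqVlt => /orP[/eqP->//|/(meshsize_lt q1 hq) h].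
by apply: le_trans h _; rewrite ler_piMl ?meshsize_ge0// invf_le1 ?ltr0n// ler1n.
Qed.

End meshsize.

Lemma ler_fsum (R : numDomainType) (I : choiceType) (P : set I) (F G : I -> R) :
  finite_set P -> (forall i, P i -> F i <= G i) ->
  \sum_(i \in P) F i <= \sum_(i \in P) G i.
Proof.
move=> fP FG; rewrite !fsbig_finite// big_seq [leRHS]big_seq.
by apply: ler_sum => i; rewrite in_fset_set// => /set_mem; exact: FG.
Qed.

Section weighted_integrals.
Context (R : realType) (d : nat).
Variables (p : 'I_d -> nat) (Xi : nat -> 'I_d -> seq R).
Hypothesis Xi_open : forall l i, open_knot_vector (p i) (Xi l i).
Hypothesis d_gt0 : (0 < d)%N.
Variable r : 'rV[R]_d -> R.
Local Notation leb := (lebesgue_rV R d).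
Local Notation tb := (tbspline p Xi).
Hypothesis mr : measurable_fun setT r.
Hypothesis ir : leb.-integrable setT (EFin \o (fun x => r x ^+ 2)).

(** Integrating over the whole space instead of the support gives all basis functions the same
    domain, which makes the integral linear in the spline. *)
Definition weighted_integral (be : label d) : R := \int[leb]_x (r x ^+ 2 * tb be x).

Lemma integrable_weighted be :
  leb.-integrable setT (EFin \o (fun x => r x ^+ 2 * tb be x)).
Proof.
(* Only the sup bound matters here, so any direction will do; [d_gt0] supplies one. *)
have [M [M0 bM _]] : right_lipschitz (Ordinal d_gt0) (tb be).
  by apply: right_lipschitz_prod => j; exact: right_lipschitz_bspline.
apply: le_integrable (integrableZl measurableT M ir) => //.
  apply/measurable_EFinP; apply: measurable_funM; first exact: measurable_funX.
  exact: measurable_tbspline.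
move=> x _ /=; rewrite lee_fin mulrC !normrM ler_wpM2r// (ger0_norm M0).
have [->|bx] := eqVneq (tb be x) 0; first by rewrite normr0.
by apply: bM; exact: tbspline_cube bx.
Qed.

Lemma weighted_integral_ge0 l be : tbasis p Xi l be -> 0 <= weighted_integral be.
Proof.
move=> tbe; apply: Rintegral_ge0 => x _.
by rewrite mulr_ge0 ?sqr_ge0//; exact: tbspline_ge0 tbe.
Qed.

(** Integrability is carried along in the induction because additivity of the integral requires it
    at each step. *)
Lemma weighted_integral_sum (s : seq (label d)) (C : label d -> R) :
  \int[leb]_x (r x ^+ 2 * \sum_(b <- s) C b * tb b x) =
    \sum_(b <- s) C b * weighted_integral b /\
  leb.-integrable setT (EFin \o (fun x => r x ^+ 2 * \sum_(b <- s) C b * tb b x)).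
Proof.
elim: s => [|b s [IHe IHi]].
  rewrite big_nil (_ : (fun x => _) = cst 0).
    by rewrite Rintegral_cst// mul0r; split => //; exact: integrable0.
  by apply/funext => x; rewrite big_nil mulr0.
rewrite (_ : (fun x => _) = (fun x => C b * (r x ^+ 2 * tb b x) +
    r x ^+ 2 * \sum_(b <- s) C b * tb b x)); last first.
  by apply/funext => x; rewrite big_cons mulrDr mulrCA.
have iC : leb.-integrable setT (EFin \o (fun x => C b * (r x ^+ 2 * tb b x))).
  exact: (integrableZl measurableT (C b) (integrable_weighted b)).
split; last exact: (integrableD measurableT iC IHi).
rewrite RintegralD// IHe big_cons RintegralZl//.
exact: integrable_weighted.
Qed.

Lemma weighted_integral_decomposes H be C : finite_set H -> decomposes p Xi H be C ->
  weighted_integral be = \sum_(b \in H) C b * weighted_integral b.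
Proof.
move=> fH [_ _ Cs]; rewrite (fsbig_finite _ _ fH).
rewrite -(weighted_integral_sum _ C).1 /weighted_integral; congr Rintegral.
apply/funext => x; congr (_ * _).
have [cx|ncx] := pselect (cube x); first by rewrite Cs// fsbig_finite.
(* Decompositions hold on the cube only; outside it all B-splines vanish. *)
have tb0 b : tb b x = 0.
  by apply/eqP/negPn/negP => /(tbspline_cube Xi_open).
by rewrite tb0 big1// => b _; rewrite tb0 mulr0.
Qed.

Lemma local_estimatorE (a : label d -> R) l be : tbasis p Xi l be -> 0 <= a be ->
  local_estimator p Xi a r be ^+ 2 =
  a be * meshsize Xi be.1 ^+ 2 * weighted_integral be.
Proof.
move=> tbe a0; rewrite /local_estimator.
have -> : \int[leb]_(x in supp p Xi be) (`|r x| ^+ 2 * tb be x) = weighted_integral be.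
  rewrite Rintegral_mkcond; congr Rintegral; apply/funext => x; rewrite patchE.
  case: ifPn => [_|/negP xs]; first by rewrite -normrX ger0_norm ?sqr_ge0.
  have [->|bx] := eqVneq (tb be x) 0; first by rewrite mulr0.
  by exfalso; apply: xs; apply: mem_set; exact: tbspline_supp.
by rewrite !exprMn !sqr_sqrtr//; exact: weighted_integral_ge0 tbe.
Qed.

Lemma estimatorE (a : label d -> R) (N : set (label d)) :
  (forall be, N be -> tbasis p Xi be.1 be /\ 0 <= a be) ->
  estimator p Xi a r N ^+ 2 =
  \sum_(be \in N) a be * meshsize Xi be.1 ^+ 2 * weighted_integral be.
Proof.
move=> hN; rewrite sqr_sqrtr; last by apply: fsumr_ge0 => be _; exact: sqr_ge0.
apply: eq_fsbigr => be /set_mem /hN[tbe a0]; exact: local_estimatorE tbe a0.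
Qed.

End weighted_integrals.

(** * Reduction of the estimator under refinement *)

Unset Implicit Arguments.

Theorem proposition6p3 (R : realType) (d : nat) (d_ge2 : (2 <= d)%N)
  (A : 'rV[R]_d -> 'M[R]_d) (b : 'rV[R]_d -> 'rV[R]_d) (c f : 'rV[R]_d -> R)
  (gamma1 gamma2 : R)
  (A_W1inf : forall i j, W1inf (@cube R d)° (fun x => A x i j))
  (A_sym : forall x, cube x -> (A x)^T = A x)
  (gamma1_gt0 : 0 < gamma1) (gamma_le : gamma1 <= gamma2)
  (A_elliptic : forall (x xi : 'rV[R]_d), cube x ->
     gamma1 * enorm xi ^+ 2 <= (xi *m A x *m xi^T) 0 0 <= gamma2 * enorm xi ^+ 2)
  (b_W1inf : forall i, W1inf (@cube R d)° (fun x => b x 0 i))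
  (c_Linf : Lp_on (@cube R d) +oo%E c)
  (bc_ge0 : {ae lebesgue_rV R d, forall x, cube x ->
     0 <= c x - 2^-1 * wdiv (@cube R d)° b x})
  (f_L2 : Lp_on (@cube R d) 2%:E f)
  (p : 'I_d -> nat) (p_ge1 : forall i, (1 <= p i)%N)
  (Xi : nat -> 'I_d -> seq R)
  (Xi_open : forall l i, open_knot_vector (p i) (Xi l i))
  (Xi_nested : nested_knots Xi)
  (cf : label d -> label d -> R) (cf_two_scale : two_scale p Xi cf)
  (q : nat) (q_ge2 : (2 <= q)%N)
  (meshsize_q : forall l, meshsize Xi l.+1 <= q%:R^-1 * meshsize Xi l)
  (n : nat) (Om Oms : nat -> set 'rV[R]_d)
  (Om_hierarchy : hierarchy Xi n Om) (Oms_enlargement : enlargement Xi n Om Oms)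
  (a as_ : label d -> R) :
  let H := hbasis p Xi cf n Om in
  let Hs := hbasis p Xi cf n.+1 Oms in
  partition_coefs p Xi H a ->
  partition_coefs p Xi Hs as_ ->
  let refined := H `\` Hs in
  let lambda := 1 - (q%:R ^+ 2)^-1 in
  forall V, hspan p Xi H V ->
  let r := residual A b c f V in
  estimator p Xi as_ r Hs ^+ 2 <=
  estimator p Xi a r H ^+ 2 - lambda * estimator p Xi a r refined ^+ 2.
Proof.
move=> H Hs aP asP refined lambda V VH; cbv zeta; set r := residual A b c f V.
have d_gt0 : (0 < d)%N by exact: leq_trans d_ge2.
have n_gt0 := hierarchy_gt0 Om_hierarchy.
have fH : finite_set H by exact: finite_hbasis.
have fHs : finite_set Hs by exact: finite_hbasis.
have [mr ir] : measurable_fun setT r /\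
    (lebesgue_rV R d).-integrable setT (EFin \o (fun x => r x ^+ 2)).
  apply: residual_measurable_integrable => //.
  - by move=> i; have [] := b_W1inf i.
  - exact: measurable_hspan fH VH.
  - by move=> i; exact: right_lipschitz_hspan fH VH.
pose I := weighted_integral p Xi r.
have tH be : H be -> tbasis p Xi be.1 be by case/hbasis_tbasis.
have tHs be : Hs be -> tbasis p Xi be.1 be by case/hbasis_tbasis.
have I0 be : tbasis p Xi be.1 be -> 0 <= I be by exact: weighted_integral_ge0.
have [Oms_hierarchy Om_Oms] := Oms_enlargement.
have [_ _ Om_sub _] := Om_hierarchy.
(* [H] is [hbasis_rec] after [n.-1] steps and [Hs] after [n]: the comparison at equal depth is
   followed by one more refinement of the enlarged basis. *)
have /choice[C HC] be : exists C, H be -> decomposes p Xi Hs be C.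
  have [Hbe|] := pselect (H be); last by exists (fun=> 0).
  have [|C0 hC0] := hbasis_decomposes cf_two_scale Om_sub Om_Oms _ Hbe.
    exact: leq_pred.
  have [C hC] := decomposes_refine cf_two_scale hC0.
  by exists C => _; move: hC; rewrite prednK.
(* Independence gives only that [D be0] times the function [be0] vanishes, so the coefficients are
   compared after multiplication by [I be0]. *)
have asI be0 : Hs be0 -> as_ be0 * I be0 = \sum_(be \in H) a be * C be be0 * I be0.
  pose D bs := as_ bs - \sum_(be \in H) a be * C be bs.
  have D0 x : cube x -> \sum_(bs \in Hs) D bs * tbspline p Xi bs x = 0.
    move=> cx; have [_ /(_ x cx) as1] := asP; have [_ /(_ x cx) a1] := aP.
    have : \sum_(bs \in Hs) \sum_(be \in H) a be * C be bs * tbspline p Xi bs x = 1.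
      rewrite exchange_fsbig// -a1; apply: eq_fsbigr => be /set_mem Hbe.
      have [_ _ ->//] := HC be Hbe.
      by rewrite mulr_fsumr; apply: eq_fsbigr => bs _; rewrite mulrA.
    rewrite -as1 => E; rewrite -[RHS](subrr (\sum_(bs \in Hs) as_ bs * tbspline p Xi bs x)).
    rewrite -{2}E !(fsbig_finite _ _ fHs) -sumrB; apply: eq_bigr => bs _.
    by rewrite mulrBl mulr_fsuml.
  move=> Hb; rewrite -mulr_fsuml; apply/eqP; rewrite -subr_eq0 -mulrBl -/(D be0).
  have DI := hbasis_independence Xi_open cf_two_scale Oms_hierarchy D0 _ Hb.
  have [->|Dn0] := eqVneq (D be0) 0; first by rewrite mul0r.
  suff -> : I be0 = 0 by rewrite mulr0.
  rewrite /I /weighted_integral (_ : (fun x => _) = cst 0) ?Rintegral_cst ?mul0r//.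
  apply/funext => x; have /eqP := DI x; rewrite mulf_eq0 (negPf Dn0) => /eqP->.
  by rewrite mulr0.
have q1 : (1 <= q)%N by exact: leq_trans q_ge2.
(* The factor bounding the drop of the squared mesh size from [be] to the functions of its
   decomposition: 1 if [be] is kept, 1/q^2 if it is refined. *)
pose mu be := if be \in Hs then 1 else (q%:R ^+ 2)^-1 : R.
have Cle be bs : H be -> Hs bs -> C be bs * (meshsize Xi bs.1 ^+ 2 * I bs) <=
    mu be * meshsize Xi be.1 ^+ 2 * (C be bs * I bs).
  move=> Hbe Hb; have [C0 Cl _] := HC be Hbe.
  have [->|Cn0] := eqVneq (C be bs) 0; first by rewrite !mul0r mulr0.
  have [bl bl'] := Cl bs Hb Cn0.
  have CI : 0 <= C be bs * I bs by rewrite mulr_ge0 ?C0// I0//; exact: tHs.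
  rewrite [leLHS]mulrCA ler_wpM2r//.
  rewrite /mu; case: ifPn => [_|/negP nHs].
    by rewrite mul1r ler_pXn2r ?nnegrE ?meshsize_ge0// (meshsize_le q1).
  rewrite -exprVn -exprMn ler_pXn2r ?nnegrE ?mulr_ge0 ?invr_ge0 ?meshsize_ge0//.
  by apply: meshsize_lt => //; apply: bl' => Hsbe; apply: nHs; exact: mem_set.
have [a0 _] := aP; have [as0 _] := asP.
have asHs be : Hs be -> tbasis p Xi be.1 be /\ 0 <= as_ be.
  by move=> Hbe; split; [exact: tHs|exact/ltW/as0].
have aH be : H be -> tbasis p Xi be.1 be /\ 0 <= a be.
  by move=> Hbe; split; [exact: tH|exact/ltW/a0].
have aR be : refined be -> tbasis p Xi be.1 be /\ 0 <= a be by case=> /aH.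
rewrite (estimatorE Xi_open r asHs) (estimatorE Xi_open r aH) (estimatorE Xi_open r aR).
rewrite -/I.
(* Both sides become double sums over [H] and [Hs], by [asI] on the left and by decomposing [I be]
   on the right, and [Cle] compares them term by term. *)
apply: (@le_trans _ _ (\sum_(be \in H) mu be * (a be * meshsize Xi be.1 ^+ 2 * I be))).
  rewrite (@eq_fsbigr _ _ _ _ _ (fun bs => \sum_(be \in H)
      a be * (C be bs * (meshsize Xi bs.1 ^+ 2 * I bs)))); last first.
    move=> bs /set_mem Hb; rewrite mulrAC asI// mulr_fsuml.
    by apply: eq_fsbigr => be _; ring.
  rewrite exchange_fsbig//; apply: ler_fsum => // be Hbe.
  have -> : I be = \sum_(bs \in Hs) C be bs * I bs.
    exact: (weighted_integral_decomposes Xi_open d_gt0 mr ir fHs (HC be Hbe)).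
  rewrite !mulr_fsumr; apply: ler_fsum => // bs Hb.
  rewrite (_ : mu be * _ = a be * (mu be * meshsize Xi be.1 ^+ 2 * (C be bs * I bs))).
    by rewrite ler_wpM2l ?Cle// ltW// a0.
  by ring.
(* What remains is an equality, since [mu] is 1 on kept functions and [1 - lambda] on refined
   ones. *)
rewrite le_eqVlt; apply/orP; left; apply/eqP.
rewrite /refined setDE fsbig_mkcondr mulr_fsumr !(fsbig_finite _ _ fH) -sumrB.
apply: eq_bigr => be _; rewrite /mu in_setC /lambda; case: (be \in Hs) => /=; ring.
Qed.
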